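(* Let $m,n\in\mathbb{N}$ and let $\vec{P}=(p_1,\ldots,p_m)$ with $p_1,\ldots,p_m\in(1,\infty)$ and $\frac1p=\frac1{p_1}+\cdots+\frac1{p_m}$. Assume that $0<p\le p_0<\frac{n}{\alpha}$, $0<p\le 1$ and $0<\beta\le\alpha<mn$. Set $\theta=\frac{n-\beta p_0}{n-\alpha p_0}$, $q=\theta p$ and $q_0=\theta p_0$. Then there is a constant $C>0$, depending only on $n,m,\alpha,\beta,\vec{P},p_0$, such that for every nonnegative Radon measure $\mu$ on $\mathbb{R}^n$ and every $\vec{f}=(f_1,\ldots,f_m)\in\mathcal{M}^{\vec{P},p_0}((\mathbb{R}^n)^m)$, \[ \|\mathfrak{I}_\alpha(\vec{f})\|_{\mathcal{M}_{\mu}^{q,q_0}(\mathbb{R}^n)} \le C\, \|\mu\|_{n-\beta p}^{1/q}\, \|\vec{f}\|_{\mathcal{M}^{\vec{P},p_0}((\mathbb{R}^n)^m)}. \]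
   Context: $\mathcal{Q}$ denotes the family of all cubes in $\mathbb{R}^n$ with sides parallel to the coordinate axes; $|Q|$ is the volume of $Q$ and $\ell_Q=|Q|^{1/n}$ its side length. For $\vec{f}=(f_1,\ldots,f_m)$ with each $f_j$ locally integrable on $\mathbb{R}^n$, the $m$-linear fractional integral operator $\mathfrak{I}_\alpha$, $0<\alpha<mn$, is \[ \mathfrak{I}_\alpha(\vec{f})(x)=\int_{(\mathbb{R}^n)^m}\frac{\prod_{j=1}^m f_j(y_j)}{(|x-y_1|+\cdots+|x-y_m|)^{mn-\alpha}}\,dy_1\cdots dy_m,\qquad x\in\mathbb{R}^n. \] For a nonnegative Radon measure $\mu$ on $\mathbb{R}^n$ and $\gamma\in(0,n]$, $\|\mu\|_\gamma=\sup_{Q\in\mathcal{Q}}\mu(Q)/\ell_Q^{\gamma}$ (possibly $+\infty$). For $0<p\le p_0<\infty$ with $1/p=1/p_1+\cdots+1/p_m$, the product Morrey space $\mathcal{M}^{\vec{P},p_0}((\mathbb{R}^n)^m)$ is the set of all $\vec{f}=(f_1,\ldots,f_m)$ (each $f_j$ locally integrable on $\mathbb{R}^n$) with \[ \|\vec{f}\|_{\mathcal{M}^{\vec{P},p_0}((\mathbb{R}^n)^m)}=\sup_{Q\in\mathcal{Q}}|Q|^{1/p_0}\prod_{j=1}^m\left(\frac1{|Q|}\int_Q|f_j(y)|^{p_j}\,dy\right)^{1/p_j}<\infty. \] For $0<q\le q_0<\infty$, the Radon-Morrey space $\mathcal{M}_\mu^{q,q_0}(\mathbb{R}^n)$ consists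 of all $\mu$-measurable functions $g$ on $\mathbb{R}^n$ with \[ \|g\|_{\mathcal{M}_\mu^{q,q_0}(\mathbb{R}^n)}=\sup_{Q\in\mathcal{Q}}|Q|^{1/q_0-1/q}\left(\int_Q|g|^q\,d\mu\right)^{1/q}<\infty. \] *)

(* Defs.v *)
From HB Require Import structures.
From mathcomp Require Import all_boot all_order all_algebra.
From mathcomp Require Import all_classical all_reals all_analysis.
From mathcomp Require Import measurable_realfun.

Set Implicit Arguments.
Unset Strict Implicit.
Unset Printing Implicit Defensive.
Import Order.TTheory GRing.Theory Num.Theory.
Import numFieldNormedType.Exports.

Local Open Scope classical_set_scope.
Local Open Scope ring_scope.

Section tuple_cons.
Context {d} {T : measurableType d}.

Definition tcons k (x : T * k.-tuple T) : k.+1.-tuple T := [tuple of x.1 :: x.2].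

Definition tuncons k (t : k.+1.-tuple T) : T * k.-tuple T :=
  (thead t, [tuple of behead t]).

Lemma tconsK k : cancel (@tcons k) (@tuncons k).
Proof.
by case=> x t; rewrite /tuncons/= theadE; congr pair; apply: val_inj.
Qed.

Lemma tunconsK k : cancel (@tuncons k) (@tcons k).
Proof. by move=> t; rewrite [RHS]tuple_eta. Qed.

Lemma measurable_tcons k : measurable_fun setT (@tcons k).
Proof. exact: measurable_cons. Qed.

Lemma measurable_tuncons k : measurable_fun setT (@tuncons k).
Proof.
apply/measurable_fun_pairP; split; first exact: measurable_tnth.
exact: measurable_behead.
Qed.

End tuple_cons.

Section tcons_measure.
Context {d} {T : measurableType d} {R : realType}.
Local Open Scope ereal_scope.
Variables (mu : {sigma_finite_measure set T -> \bar R}) (k : nat).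
Variable nu : {sigma_finite_measure set (k.-tuple T) -> \bar R}.

Definition tcons_measure : set (k.+1.-tuple T) -> \bar R :=
  pushforward (mu \x nu) (@tcons d T k).

HB.instance Definition _ := Measure.copy tcons_measure
  (measure_function_pushforward__canonical__measure_function_Measure
     (mu \x nu) (@measurable_tcons d T k)).

Let tcons_measure_sigma_finite : sigma_finite setT tcons_measure.
Proof.
have /sigma_finiteP[F [TF ndF Foo]] := sigma_finiteT mu.
have /sigma_finiteP[G [TG ndG Goo]] := sigma_finiteT nu.
exists (fun i => @tuncons d T k @^-1` (F i `*` G i)) => [|i].
  rewrite -preimage_bigcup (_ : \bigcup_i _ = setT) ?preimage_setT//.
  rewrite -setXTT TF TG predeqE => -[x y]; split.
    by move=> [n _ []/= ? ?]; split; exists n.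
  move=> [/= [n _ Fnx] [l _ Gly]]; exists (maxn n l) => //; split.
  - by move: x Fnx; exact/subsetPset/ndF/leq_maxl.
  - by move: y Gly; exact/subsetPset/ndG/leq_maxr.
have [mF Fi] := Foo i; have [mG Gi] := Goo i; split.
  rewrite -[X in measurable X]setTI; apply: measurable_tuncons => //.
  exact: measurableX.
rewrite /tcons_measure /pushforward -comp_preimage.
rewrite (_ : _ \o _ = id) ?preimage_id; last first.
  by apply/funext => x; exact: tconsK.
by rewrite product_measure1E// lte_mul_pinfty// ge0_fin_numE.
Qed.

HB.instance Definition _ := Measure_isSigmaFinite.Build _ _ _ tcons_measure
  tcons_measure_sigma_finite.

End tcons_measure.

(* The k-fold product measure mu x ... x mu on k-tuples; for k = 0 it is the
   unit mass at the empty tuple. *)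
Fixpoint tuple_measure d (T : measurableType d) (R : realType)
    (mu : {sigma_finite_measure set T -> \bar R}) (k : nat) :
    {sigma_finite_measure set (k.-tuple T) -> \bar R} :=
  if k is k'.+1 then tcons_measure mu (tuple_measure mu k')
  else \d_([tuple] : 0.-tuple T).

Lemma tuple_measure_box d (T : measurableType d) (R : realType)
    (mu : {sigma_finite_measure set T -> \bar R}) (k : nat) (A : 'I_k -> set T) :
  (forall i, measurable (A i)) ->
  tuple_measure mu k [set t | forall i, A i (tnth t i)] =
  (\prod_(i < k) mu (A i))%E.
Proof.
elim: k A => [|k IH] A mA /=.
  rewrite big_ord0 diracE (_ : _ \in _) //.
  by apply/mem_set => -[].
rewrite big_ord_recl -IH// /tcons_measure /pushforward -product_measure1E//.
  congr (_ _); apply/seteqP; split => -[x t] /=.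
    move=> H; split; first exact: (H ord0).
    by move=> i; have := H (lift ord0 i); rewrite /tcons/= tnthS.
  move=> [H0 H] i; have [->//|i0] := eqVneq i ord0.
  have [j ->] : exists j, i = lift ord0 j.
    by case: (unliftP ord0 i) i0 => [j ->|->]; [exists j|rewrite eqxx].
  by rewrite /tcons/= tnthS.
rewrite (_ : mkset _ = \big[setI/setT]_(i < k) (@tnth k T ^~ i @^-1` A (lift ord0 i))).
  apply: bigsetI_measurable => i _; rewrite -[X in measurable X]setTI.
  exact: measurable_tnth.
by rewrite -bigcap_seq; apply/seteqP; split => [t + i _|t + i]; apply => //=; 
  rewrite mem_index_enum.
Qed.

Section euclidean_space.
Context (R : realType) (n : nat).

(* R^n with its Borel (= product) sigma-algebra. *)
Definition euclid : Type := n.-tuple (measurableTypeR R).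

HB.instance Definition _ := Measurable.copy euclid (n.-tuple (measurableTypeR R)).

Definition euclid_row (x : euclid) : 'rV[R]_n := \row_i (tnth x i : R).

HB.instance Definition _ := Topological.copy euclid (initial_topology euclid_row).

Definition leb : set euclid -> \bar R := tuple_measure (@lebesgue_measure R) n.

HB.instance Definition _ := SigmaFiniteMeasure.on leb.

(* The Euclidean distance; the library norm on 'rV[R]_n is the max norm. *)
Definition euclid_dist (x y : euclid) : R :=
  Num.sqrt (\sum_(i < n) (tnth x i - tnth y i : R) ^+ 2).

(* Cubes are taken closed; replacing them by open or half-open cubes does not
   change the value of any of the suprema below. *)
Definition cube (a : euclid) (l : R) : set euclid :=
  [set x | forall i, (tnth a i <= (tnth x i : R) <= tnth a i + l)%R].

Definition cubes : set (set euclid) :=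
  [set Q | exists a l, 0 < l /\ Q = cube a l].

Definition vol (Q : set euclid) : R := fine (leb Q).

Definition side (Q : set euclid) : R := vol Q `^ n%:R^-1.

Definition radon_measure (mu : {measure set euclid -> \bar R}) : Prop :=
  [/\ forall K : set euclid, compact K -> (mu K < +oo)%E,
      forall A : set euclid, measurable A ->
        mu A = ereal_inf [set mu U | U in [set U | open U /\ A `<=` U]]
    & forall U : set euclid, open U ->
        mu U = ereal_sup [set mu K | K in [set K | compact K /\ K `<=` U]]].

(* Lebesgue measurability: preimages of Borel sets lie in the completion of the
   Borel sigma-algebra with respect to leb. *)
Definition lebesgue_measurable_fun (f : euclid -> R) : Prop :=
  forall B : set (measurableTypeR R), measurable B ->
    completed_algebra_gen leb (f @^-1` B).

Definition locally_integrable_on_euclid (f : euclid -> R) : Prop :=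
  lebesgue_measurable_fun f /\
  forall K : set euclid, compact K ->
    (\int[leb]_(y in K) `|f y|%:E < +oo)%E.

End euclidean_space.

Section morrey.
Context (R : realType) (n : nat).
Local Open Scope ereal_scope.
Implicit Types mu : {measure set (euclid R n) -> \bar R}.

(* ||mu||_gamma *)
Definition measure_norm mu (gamma : R) : \bar R :=
  ereal_sup [set mu Q * ((side Q `^ gamma)^-1)%:E | Q in @cubes R n].

(* The norm of M_mu^{q,q0}, for functions with values in the extended reals. *)
Definition radon_morrey_norm mu (q q0 : R) (g : euclid R n -> \bar R) : \bar R :=
  ereal_sup [set (vol Q `^ (q0^-1 - q^-1))%:E *
                 (\int[mu]_(x in Q) (`|g x| `^ q)) `^ q^-1 | Q in @cubes R n].

Context (m : nat).
Implicit Types f : 'I_m -> euclid R n -> R.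

Definition product_morrey_norm (P : 'I_m -> R) (p0 : R) f : \bar R :=
  ereal_sup [set (vol Q `^ p0^-1)%:E *
                 \prod_(j < m)
                   ((vol Q)^-1%:E *
                    \int[@leb R n]_(y in Q) (`|f j y| `^ P j)%:E) `^ (P j)^-1
            | Q in @cubes R n].

Definition product_morrey (P : 'I_m -> R) (p0 : R) f : Prop :=
  (forall j, locally_integrable_on_euclid (f j)) /\
  product_morrey_norm P p0 f < +oo.

(* The integral is the difference of the integrals of the positive and negative
   parts, with +oo - +oo = -oo: where it does not converge absolutely, its value
   is infinite.  At y_1 = ... = y_m = x the kernel is 0^-1 = 0, which affects
   only a null set. *)
Definition fractional_integral (alpha : R) f (x : euclid R n) : \bar R :=
  \int[tuple_measure (@leb R n) m]_y
    ((\prod_(j < m) f j (tnth y j)) /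
     (\sum_(j < m) euclid_dist x (tnth y j)) `^ (m%:R * n%:R - alpha))%:E.

End morrey.

(* Main.v *)
Require Import Defs.
From HB Require Import structures.
From mathcomp Require Import all_boot all_order all_algebra.
From mathcomp Require Import all_classical all_reals all_analysis.
From mathcomp Require Import measurable_realfun.
From mathcomp Require Import ring lra.

Set Implicit Arguments.
Unset Strict Implicit.
Unset Printing Implicit Defensive.
Import Order.TTheory GRing.Theory Num.Theory.
Import numFieldNormedType.Exports.

Local Open Scope classical_set_scope.
Local Open Scope ring_scope.

(* Everything reduces to nonnegative Borel f_j, and to a fixed cube Q_0 of side l.

   Decomposing the kernel dyadically and covering each small ball centred in Q_0
   by a cell of one of 2^n shifted grids (one-third trick) gives
     I_alpha f(x) <= c (S_0 + sum_(k >= 0) rho_k^alpha u_k(x)),  rho_k = 2^-k l/6,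
   where u_k(x) is a sum over the grids of the products over j of the averages
   of f_j on the cell of level k containing x.  The far part S_0 is controlled
   by the Morrey norm N alone, and u_k <= C N rho_k^(-n/p_0).

   Let S_k be the partial sums.  Telescoping S_k^q and inserting the Morrey bound
   for u_k yields
     S_K^q <= S_0^q + C N^(q-p) sum_(k <= K) rho_k^(beta p) u_k^p.

   To integrate the right-hand side against mu, replace u_k^p in each grid by
   a_k = prod_j (M_k f_j)^p, with M_k the maximum of the averages of levels
   0, ..., k.  Now a_k increases with k and is constant on the cells of level k,
   so after summation by parts only the increments a_i - a_(i-1) occur, and
   mu(cell) <= ||mu|| (side)^(n - beta p) turns their mu-integrals, weighted by
   rho_i^(beta p), into Lebesgue integrals that telescope to the integral of a_K.
   Hoelder's inequality and Doob's maximal inequality in each L^(p_j) bound it. *)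

(** * Real inequalities *)

(** On cells of side s the hypothesis bounds mu by s^(-beta p) times Lebesgue measure, and the
    weight rho_k^(beta p) cancels exactly this factor. No decay is left over: estimating the levels
    one by one would cost a factor growing with K. Summation by parts avoids the loss, but the
    averages are not monotone in k and their increments have no sign; this is why the maxima enter.

    All exponents fit through the single identity q (e - alpha) = p (e - beta) with e = n/p_0. The
    condition p <= 1 acts twice: t^p is subadditive over the grids, and in the telescoping step a
    factor u^(1-p) is bounded by the Morrey estimate. This includes the endpoint beta = alpha, where
    q = p.

    I_alpha f is treated without proving it measurable. Integrals of nonnegative functions are then
    lower integrals, which are monotone but not known to be additive; majorants are therefore always
    chosen measurable. *)

Section real_inequalities.
Context {R : realType}.
Implicit Types (a b x y p q : R).

(** The tangent at [x] of the convex function t^q lies below its graph at [y]. This is Young's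
    inequality for [y] and x^(q-1) with exponents q and q/(q-1); the second degenerates at q = 1,
    which is treated apart. *)
Lemma mulr_powRB1_young q x y : 1 <= q -> 0 <= x -> 0 <= y ->
  q * (y * x `^ (q - 1)) <= y `^ q + (q - 1) * x `^ q.
Proof.
move=> q1 x0 y0; have [->|qn1] := eqVneq q 1.
  by rewrite subrr powRr0 mul0r addr0 mulr1 mul1r powRr1.
have q1' : 1 < q by rewrite lt_neqAle eq_sym qn1.
have q0 : 0 < q by lra.
have qm : 0 < q / (q - 1) by rewrite divr_gt0//; lra.
have := @conjugate_powR R y (x `^ (q - 1)) q (q / (q - 1)) y0 (powR_ge0 _ _) q0 qm.
rewrite -powRrM mulrCA divff ?mulr1; last by lra.
move=> /(_ _)H; rewrite -ler_pdivlMl//; apply: (le_trans (H _)).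
  by rewrite invf_div -{1}[q^-1]mul1r -mulrDl; rewrite addrC subrK divff//; lra.
by rewrite invf_div mulrDr [q^-1 * y `^ q]mulrC; rewrite lerD2l le_eqVlt; apply/orP; left; apply/eqP; field; lra.
Qed.

Lemma powRD_le_tangent q a b : 1 <= q -> 0 <= a -> 0 <= b ->
  (a + b) `^ q <= a `^ q + q * (a + b) `^ (q - 1) * b.
Proof.
move=> q1 a0 b0; have ab0 : 0 <= a + b by lra.
have := mulr_powRB1_young q1 ab0 a0.
have := @mulr_powRB1 R (a + b) q ab0 ltac:(lra).
move: (_ `^ (q - 1)) (_ `^ q) (a `^ q) => z w v <-; nra.
Qed.

(** For t in [0,1] and q <= 1 one has t <= t^q; this is applied to the shares a/(a+b) and b/(a+b),
    which sum to 1. *)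
Lemma powRD_le_subadd q a b : 0 < q -> q <= 1 -> 0 <= a -> 0 <= b ->
  (a + b) `^ q <= a `^ q + b `^ q.
Proof.
move=> q0 q1 a0 b0; have [ab|ab] := eqVneq (a + b) 0.
  by rewrite ab powR0 ?gt_eqF// addr_ge0 ?powR_ge0.
have s0 : 0 < a + b by rewrite lt_neqAle eq_sym ab addr_ge0.
have key c : 0 <= c -> c <= a + b -> (a + b) `^ q * (c / (a + b)) <= c `^ q.
  move=> c0 cs; have [->|cn0] := eqVneq c 0.
    by rewrite mul0r mulr0 powR_ge0.
  have c1 : 0 < c / (a + b) by rewrite divr_gt0// lt_neqAle eq_sym cn0.
  rewrite -{2}(@divfK _ (a + b) ab c) [in leRHS]mulrC powRM ?(ltW s0) ?(ltW c1)//.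
  rewrite ler_wpM2l ?powR_ge0// ger1_powR// c1/=.
  by rewrite ler_pdivrMr// mul1r.
have := lerD (key _ a0 ltac:(lra)) (key _ b0 ltac:(lra)).
by rewrite -mulrDr -mulrDl divff// mulr1.
Qed.

Lemma powR_sum_le_subadd q (I : Type) (s : seq I) (F : I -> R) :
  0 < q -> q <= 1 -> (forall i, 0 <= F i) ->
  (\sum_(i <- s) F i) `^ q <= \sum_(i <- s) F i `^ q.
Proof.
move=> q0 q1 F0; elim: s => [|i s IH].
  by rewrite !big_nil powR0// gt_eqF.
rewrite !big_cons; apply: (le_trans (powRD_le_subadd _ _ _ _)) => //.
  exact: sumr_ge0.
by rewrite lerD2l.
Qed.

(** [mulr_powRB1_young] with [x] and [y] exchanged. Increments of x^q become x times increments of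
    x^(q-1), which replaces integration over level sets in Doob's inequality. *)
Lemma powR_increment_le q x y : 1 < q -> 0 <= x -> 0 <= y ->
  (q - 1) * (x `^ q - y `^ q) <= q * (x * (x `^ (q - 1) - y `^ (q - 1))).
Proof.
move=> q1 x0 y0; have := mulr_powRB1_young (ltW q1) y0 x0.
have := @mulr_powRB1 R x q x0 ltac:(lra).
move: (x `^ (q - 1)) (x `^ q) (y `^ q) (y `^ (q - 1)) => a b c d <-; nra.
Qed.

(** If x <= e y the first term suffices, otherwise y < x/e and the second does. Small [e] serves for
    absorption in Doob's inequality; y = 1 gives Hoelder's inequality on a cube up to a constant. *)
Lemma mulr_powRB1_split q x y e : 1 < q -> 0 <= x -> 0 <= y -> 0 < e ->
  x * y `^ (q - 1) <= e * y `^ q + e `^ (1 - q) * x `^ q.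
Proof.
move=> q1 x0 y0 e0; have q0 : 0 < q by lra.
have [xe|/ltW xe] := leP x (e * y).
  rewrite -[leLHS]addr0 lerD//; last by rewrite mulr_ge0 ?powR_ge0.
  by rewrite -(mulr_powRB1 y0 q0) mulrA ler_wpM2r// powR_ge0.
rewrite -[leLHS]add0r lerD//; first by rewrite mulr_ge0 ?powR_ge0 ?ltW.
rewrite -(mulr_powRB1 x0 q0) mulrCA ler_wpM2l//.
have -> : 1 - q = - (q - 1) by lra.
rewrite powRN ler_pdivlMl ?powR_gt0// -powRM ?(ltW e0)//.
by rewrite ge0_ler_powR ?nnegrE ?mulr_ge0 ?(ltW e0)//; lra.
Qed.

(** A crude weighted arithmetic-geometric inequality: each [t j] is at most the whole sum, and the
    exponents add up to 1. It stands in for Hoelder's inequality once the factors are normalised. *)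
Lemma prod_powR_le_sum (m : nat) (w t : 'I_m -> R) :
  (forall j, 0 < w j) -> \sum_j w j = 1 -> (forall j, 0 <= t j) ->
  \prod_j t j `^ w j <= \sum_j t j.
Proof.
move=> w0 w1 t0; set S := \sum_j t j.
have S0 : 0 <= S by exact: sumr_ge0.
have tS j : t j <= S by rewrite /S (bigD1 j)//= lerDl sumr_ge0.
have : \prod_j t j `^ w j <= \prod_j S `^ w j.
  apply: ler_prod => j _; rewrite powR_ge0/= ge0_ler_powR ?nnegrE//.
  exact: ltW.
move=> /le_trans; apply.
have [SE|Sn] := eqVneq S 0.
  have [j] : exists j : 'I_m, true.
    case: m w t w0 w1 {t0 S S0 tS SE} => [w t _|m w t _ _]; last by exists ord0.
    by rewrite big_ord0 => /esym/eqP; rewrite oner_eq0.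
  by rewrite SE (bigD1 j)//= powR0 ?mul0r// gt_eqF.
suff -> : \prod_j S `^ w j = S `^ (\sum_j w j) by rewrite w1 powRr1.
elim/big_rec2: _ => [|j x y _ ->]; first by rewrite powRr0.
by rewrite powRD// Sn implybT.
Qed.

Lemma powR_prod (I : Type) (s : seq I) (F : I -> R) q :
  (forall i, 0 <= F i) ->
  (\prod_(i <- s) F i) `^ q = \prod_(i <- s) F i `^ q.
Proof.
move=> F0; elim: s => [|i s IH]; first by rewrite !big_nil powR1.
by rewrite !big_cons powRM ?IH// prodr_ge0.
Qed.

(* Any finite family with a vanishing member can be dominated by positive
   numbers with an arbitrarily small weighted product. *)
Lemma exists_pos_majorant (m : nat) (w F : 'I_m -> R) (B : R) :
  (forall j, 0 < w j) -> (forall j, 0 <= F j) -> 0 < B ->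
  \prod_j F j `^ w j <= B ->
  exists G : 'I_m -> R, [/\ forall j, 0 < G j, forall j, F j <= G j &
    \prod_j G j `^ w j <= B].
Proof.
move=> w0 F0 B0 FB.
have [/existsP[i /eqP Fi]|] := boolP [exists i, F i == 0]; last first.
  rewrite negb_exists => /forallP Fn; exists F; split=> // j.
  by rewrite lt_neqAle eq_sym Fn F0.
pose X := \prod_(j < m | j != i) (F j + 1) `^ w j.
have X0 : 0 < X.
  by apply: prodr_gt0 => j _; rewrite powR_gt0// ltr_pwDr.
exists (fun j => if j == i then (B / X) `^ (w i)^-1 else F j + 1); split.
- move=> j; case: ifP => _; first by rewrite powR_gt0// divr_gt0.
  by rewrite ltr_pwDr.
- move=> j; case: ifP => [/eqP ->|_]; first by rewrite Fi powR_ge0.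
  by rewrite lerDl.
rewrite (bigD1 i)//= eqxx -powRrM mulVf ?gt_eqF// powRr1; last first.
  by rewrite divr_ge0// ltW.
rewrite (eq_bigr (fun j => (F j + 1) `^ w j)); last by move=> j /negbTE ->.
by rewrite -/X divfK// gt_eqF.
Qed.

Lemma abel_geometric_sum (l : R) (a : nat -> R) (K : nat) :
  (1 - l) * (\sum_(k < K.+1) l ^+ k * a k) =
  a 0%N + \sum_(i < K) l ^+ i.+1 * (a i.+1 - a i) - l ^+ K.+1 * a K.
Proof.
elim: K => [|K IH].
  by rewrite big_ord_recr !big_ord0 /= expr1 expr0; ring.
rewrite big_ord_recr/= mulrDr IH [in RHS]big_ord_recr/=.
by rewrite !exprS; ring.
Qed.

End real_inequalities.

(** * Telescoping of powers of dyadic sums *)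

Section hedberg.
Context {R : realType}.
Implicit Types (p q alpha beta e A r N : R) (u : nat -> R).

(** The bounds N rho_k^(alpha-e) grow geometrically, by the factor 1/w with w = 2^(alpha-e) < 1, so
    the last one controls the sum. B = A + 1/(1-w) satisfies B w + 1 <= B, which is what the
    induction step requires. *)
Lemma dyadic_partial_sum_le alpha e A r N u S0 :
  alpha < e -> 0 <= A -> 0 < r -> 0 < N ->
  (forall k, u k <= N * (r / 2 ^+ k) `^ (- e)) ->
  S0 <= A * N * r `^ (alpha - e) -> forall K,
  S0 + \sum_(k < K.+1) (r / 2 ^+ k) `^ alpha * u k <=
  (A + (1 - 2 `^ (alpha - e))^-1) * N * (r / 2 ^+ K) `^ (alpha - e).
Proof.
move=> ae A0 r0 N0 uN S0A.
set w := 2 `^ (alpha - e); set B := A + _.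
have w0 : 0 < w by rewrite powR_gt0.
have w1 : w < 1.
  rewrite /w -opprB powRN invf_lt1 ?powR_gt0//.
  have E : 1 `^ (e - alpha) = 1 :> R by rewrite powR1.
  rewrite -[ltLHS]E; apply: gt0_ltr_powR; rewrite ?nnegrE ?subr_gt0//.
  by rewrite ltr1n.
have rk k : 0 < r / 2 ^+ k by rewrite divr_gt0// exprn_gt0.
have incr k : (r / 2 ^+ k) `^ alpha * u k <= N * (r / 2 ^+ k) `^ (alpha - e).
  apply: (le_trans (ler_wpM2l (powR_ge0 _ _) (uN k))).
  by rewrite mulrCA -powRD// (gt_eqF (rk k)) implybT.
have B1 : 1 <= B * (1 - w).
  rewrite /B mulrDl mulVf; last by lra.
  by rewrite lerDr mulr_ge0//; lra.
have BA : A + 1 <= B.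
  by rewrite lerD2l invf_ge1; lra.
elim=> [|K IH].
  rewrite big_ord_recr big_ord0/= add0r expr0 divr1.
  have := incr 0%N; rewrite expr0 divr1 => H.
  apply: (le_trans (lerD S0A H)).
  rewrite -mulrA -{2}[N * _]mul1r -mulrDl -[leRHS]mulrA ler_wpM2r//.
  by rewrite mulr_ge0 ?powR_ge0 ?ltW.
rewrite big_ord_recr/= addrA; apply: (le_trans (lerD IH (incr K.+1))).
have -> : (r / 2 ^+ K) `^ (alpha - e) = w * (r / 2 ^+ K.+1) `^ (alpha - e).
  rewrite /w -powRM//; last exact/ltW.
  congr (_ `^ _); rewrite exprS; field.
  by rewrite gt_eqF// exprn_gt0.
have : 0 <= N * (r / 2 ^+ K.+1) `^ (alpha - e).
  by rewrite mulr_ge0 ?powR_ge0 ?ltW.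
move: (_ `^ (alpha - e)) => z z0.
rewrite -!mulrA [N * (w * z)]mulrCA.
move: (N * z) z0 => y y0; nra.
Qed.

(* Telescoping [S_k `^ q] plays the role of Hedberg's optimisation of the
   splitting radius: the partial sums are controlled by their last term
   because [alpha < e]. *)
Lemma hedberg_sum p q alpha beta e A :
  0 < p -> p <= 1 -> p <= q -> alpha < e ->
  q * (e - alpha) = p * (e - beta) -> 0 <= A ->
  exists2 C, 0 < C & forall r N u S0 K, 0 < r -> 0 < N ->
    (forall k, 0 <= u k <= N * (r / 2 ^+ k) `^ (- e)) ->
    0 <= S0 <= A * N * r `^ (alpha - e) ->
    (S0 + \sum_(k < K) (r / 2 ^+ k) `^ alpha * u k) `^ q <=
    S0 `^ q + C * N `^ (q - p) *
      (\sum_(k < K) (r / 2 ^+ k) `^ (beta * p) * u k `^ p).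
Proof.
move=> p0 p1 pq ae qp A0.
set B := A + (1 - 2 `^ (alpha - e))^-1.
(* The two summands serve the cases q > 1 and q <= 1 of the induction step. *)
exists (q * B `^ (q - 1) + 1).
  by rewrite ltr_wpDl// mulr_ge0 ?powR_ge0//; lra.
move=> r N u S0 K r0 N0 uN /andP[S00 S0A].
have rk k : 0 < r / 2 ^+ k by rewrite divr_gt0// exprn_gt0.
have u0 k : 0 <= u k by case/andP: (uN k).
have uN' k : u k <= N * (r / 2 ^+ k) `^ (- e) by case/andP: (uN k).
have partial := dyadic_partial_sum_le ae A0 r0 N0 uN' S0A.
have q0 : 0 < q by lra.
have t0 k : 0 <= (r / 2 ^+ k) `^ alpha * u k by rewrite mulr_ge0 ?powR_ge0.
elim: K => [|K IH]; first by rewrite !big_ord0 mulr0 !addr0.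
rewrite [leRHS](_ : _ = (S0 `^ q + (q * B `^ (q - 1) + 1) * N `^ (q - p) *
    (\sum_(k < K) (r / 2 ^+ k) `^ (beta * p) * u k `^ p)) +
  (q * B `^ (q - 1) + 1) * N `^ (q - p) *
   ((r / 2 ^+ K) `^ (beta * p) * u K `^ p)); last first.
  by rewrite big_ord_recr/= mulrDr addrA.
have step z : z <= q * B `^ (q - 1) + 1 ->
  z * (N `^ (q - p) * ((r / 2 ^+ K) `^ (beta * p) * u K `^ p)) <=
  (q * B `^ (q - 1) + 1) * N `^ (q - p) *
   ((r / 2 ^+ K) `^ (beta * p) * u K `^ p).
  move=> zl; rewrite -[leRHS]mulrA ler_wpM2r//.
  by rewrite mulr_ge0 ?mulr_ge0 ?powR_ge0.
set S := S0 + \sum_(k < K) _ in IH.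
have SS : 0 <= S by rewrite addr_ge0// sumr_ge0.
have part : S + (r / 2 ^+ K) `^ alpha * u K <=
    B * N * (r / 2 ^+ K) `^ (alpha - e).
  by have := partial K; rewrite big_ord_recr/= addrA.
rewrite big_ord_recr/= addrA -/S.
set x := r / 2 ^+ K in part step *; have x0 : 0 < x by exact: rk.
have xE y z : x `^ (y + z) = x `^ y * x `^ z.
  by rewrite powRD// (gt_eqF x0) implybT.
have NE y z : N `^ (y + z) = N `^ y * N `^ z.
  by rewrite powRD// (gt_eqF N0) implybT.
(* For q <= 1, split u^q = u^p u^(q-p) and bound the second factor by (N x^(-e))^(q-p). The
   remaining power of x is alpha q - e (q - p) = beta p. *)
have [q1|/ltW q1] := leP q 1.
  apply: (le_trans (powRD_le_subadd q0 q1 SS (t0 K))).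
  apply: lerD => //; apply: le_trans (step 1 _); last first.
    by rewrite lerDr mulr_ge0 ?powR_ge0// ltW.
  rewrite mul1r -/x powRM ?powR_ge0// -powRrM.
  have uq : u K `^ q = u K `^ p * u K `^ (q - p).
    by rewrite -powRD addrC subrK// gt_eqF.
  rewrite uq.
  have : u K `^ (q - p) <= (N * x `^ (- e)) `^ (q - p).
    by rewrite ge0_ler_powR ?nnegrE ?subr_ge0// mulr_ge0 ?powR_ge0// ltW.
  move=> /(ler_wpM2l (mulr_ge0 (powR_ge0 x (alpha * q)) (powR_ge0 (u K) p))).
  rewrite -mulrA => /le_trans; apply.
  rewrite powRM ?powR_ge0 ?(ltW N0)// -powRrM.
  rewrite (_ : beta * p = alpha * q + - e * (q - p)) ?xE; last by lra.
  by rewrite le_eqVlt; apply/orP; left; apply/eqP; ring.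
(* For q >= 1, the factor of exponent q - 1 is bounded by the last-term estimate, and u = u^p
   u^(1-p) with u^(1-p) bounded by the Morrey estimate. *)
apply: (le_trans (powRD_le_tangent q1 SS (t0 K))).
apply: lerD => //; apply: le_trans (step (q * B `^ (q - 1)) _); last first.
  by rewrite lerDl.
rewrite -!mulrA ler_wpM2l ?(ltW q0)//.
have B0 : 0 <= B.
  have : 0 <= B * N * x `^ (alpha - e) by apply: le_trans part; rewrite addr_ge0 ?t0.
  by rewrite pmulr_lge0 ?powR_gt0// pmulr_lge0.
have SB : (S + x `^ alpha * u K) `^ (q - 1) <=
    (B * N * x `^ (alpha - e)) `^ (q - 1).
  apply: ge0_ler_powR; rewrite ?subr_ge0 ?nnegrE//.
    exact: addr_ge0 (t0 K).
  by rewrite !mulr_ge0 ?powR_ge0 ?(ltW N0).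
have uK : u K <= u K `^ p * (N * x `^ (- e)) `^ (1 - p).
  have [->|un] := eqVneq (u K) 0; first by rewrite powR0 ?mul0r// gt_eqF.
  rewrite -{1}[u K]powRr1// -{1}[1](subrK p) addrC powRD ?un ?implybT//.
  apply: ler_wpM2l; first exact: powR_ge0.
  have NX : 0 <= N * x `^ (- e) by rewrite mulr_ge0 ?powR_ge0 ?(ltW N0).
  by apply: ge0_ler_powR; rewrite ?subr_ge0 ?nnegrE.
have := ler_pM (powR_ge0 _ _) (t0 K) SB (ler_wpM2l (powR_ge0 x alpha) uK).
rewrite -/x => /le_trans; apply.
have -> : (B * N * x `^ (alpha - e)) `^ (q - 1) =
    B `^ (q - 1) * N `^ (q - 1) * x `^ ((alpha - e) * (q - 1)).
  have BN0 : 0 <= B * N by rewrite mulr_ge0 ?(ltW N0).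
  by rewrite (powRM _ BN0 (powR_ge0 _ _)) (powRM _ B0 (ltW N0)) -powRrM.
have -> : (N * x `^ (- e)) `^ (1 - p) = N `^ (1 - p) * x `^ (- e * (1 - p)).
  by rewrite (powRM _ (ltW N0) (powR_ge0 _ _)) -powRrM.
rewrite (_ : beta * p = (alpha - e) * (q - 1) + alpha + - e * (1 - p)) ?xE; last by lra.
rewrite (_ : q - p = (q - 1) + (1 - p)) ?NE; last by lra.
by rewrite le_eqVlt; apply/orP; left; apply/eqP; ring.
Qed.

End hedberg.

(** * Averages over nested countable partitions *)

Section countable_fibers.
Context d (T : measurableType d) (R : realType) (I : countType) (c : T -> I).
Hypothesis mc : forall i, measurable (c @^-1` [set i]).
Local Open Scope ereal_scope.

(** The fibers of [c] encode a countable measurable partition, and a preimage under [h] is a union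
    of fibers. Measurability of cell averages and of their maxima is obtained in this way. *)
Lemma measurable_fun_fiberwise d' (U : measurableType d') (h : T -> U) :
  (forall x y, c x = c y -> h x = h y) -> measurable_fun setT h.
Proof.
move=> ch _ B mB; rewrite setTI.
pose F i := if `[< exists2 x, B (h x) & c x = i >] then c @^-1` [set i] else set0.
rewrite (_ : _ @^-1` _ = \bigcup_i F i).
  apply: countable_bigcupT_measurable => // i.
  by rewrite /F; case: ifP => _; [exact: mc|exact: measurable0].
apply/seteqP; split => x /=.
  move=> Bhx; exists (c x) => //; rewrite /F.
  by case: ifPn => // /asboolPn; apply: contra_notP => _; exists x.
case=> i _; rewrite /F; case: ifPn => // /asboolP[y By cy] /= cx.
by rewrite (ch x y)// cx cy.
Qed.

(** Fibers numbered by natural numbers, so that integrals split into series; a number that codes no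
    value of [c] gives the empty set. *)
Let F k := [set x | pickle (c x) = k].

Let mF k : measurable (F k).
Proof.
have [[x Fx]|nF] := pselect (exists x, F k x); last first.
  by rewrite (_ : F k = set0)//; apply/seteqP; split => // x Fx; apply: nF; exists x.
rewrite (_ : F _ = c @^-1` [set c x])//; apply/seteqP; split => y /=.
  by rewrite /F/= -Fx => /(pcan_inj pickleK).
by rewrite -Fx /F/= => ->.
Qed.

Let F_fiber x : F (pickle (c x)) = c @^-1` [set c x].
Proof.
apply/seteqP; split => y /=; first by move/(pcan_inj pickleK).
by rewrite /F/= => ->.
Qed.

Let integral_fibers (mu : {measure set T -> \bar R}) (f : T -> \bar R) :
  measurable_fun setT f -> (forall x, 0 <= f x) ->
  \int[mu]_x f x = \sum_(0 <= k <oo) \int[mu]_(x in F k) f x.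
Proof.
move=> mf f0.
have FT : \bigcup_k F k = setT.
  by apply/seteqP; split => // x _; exists (pickle (c x)).
rewrite -FT (ge0_integral_bigcup _ mF) ?FT//.
by move=> i j _ _ [x [<- <-]].
Qed.

Let F_eq0 k (g : T -> \bar R) (mu : {measure set T -> \bar R}) :
  ~ (exists x, F k x) -> \int[mu]_(x in F k) g x = 0.
Proof.
move=> nF; rewrite (_ : F k = set0) ?integral_set0//.
by apply/seteqP; split => // x Fx; apply: nF; exists x.
Qed.

Lemma le_integral_fiberwise (mu nu : {measure set T -> \bar R}) (A : R)
    (h : T -> \bar R) :
  (forall x, mu (c @^-1` [set c x]) <= A%:E * nu (c @^-1` [set c x])) ->
  (0 <= A)%R ->
  (forall x y, c x = c y -> h x = h y) -> (forall x, 0 <= h x) ->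
  \int[mu]_x h x <= A%:E * \int[nu]_x h x.
Proof.
move=> munu A0 ch h0; have mh := measurable_fun_fiberwise ch.
rewrite -ge0_integralZl_EFin//.
rewrite integral_fibers// [leRHS]integral_fibers//; last 2 first.
  exact: measurable_funeM.
  by move=> x; rewrite mule_ge0.
apply: lee_nneseries => [k _ _|k _]; first exact: integral_ge0.
have [[x Fx]|nF] := pselect (exists x, F k x); last by rewrite !F_eq0.
have cF y : F k y -> h y = h x by move=> Fy; apply/ch/(pcan_inj pickleK); rewrite Fy Fx.
rewrite (eq_integral (cst (h x))); last by move=> y /set_mem /cF.
rewrite [leRHS](eq_integral (cst (A%:E * h x))); last by move=> y /set_mem /cF ->.
rewrite !integral_cst// -Fx F_fiber [A%:E * _]muleC -muleA.
by rewrite lee_wpmul2l.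
Qed.

(** When all fibers have measure [V], this is the conditional expectation of [f] given the
    partition. *)
Definition fiber_average (nu : set T -> \bar R) (V : R) (f : T -> R) (x : T) : R :=
  (V^-1 * fine (\int[nu]_(y in c @^-1` [set c x]) (f y)%:E))%R.

Lemma fiber_average_fiberwise nu V f x y :
  c x = c y -> fiber_average nu V f x = fiber_average nu V f y.
Proof. by rewrite /fiber_average => ->. Qed.

Variables (nu : {measure set T -> \bar R}) (V : R).
Hypothesis V0 : (0 < V)%R.
Hypothesis nuV : forall x, nu (c @^-1` [set c x]) = V%:E.

Lemma fiber_average_ge0 f x : (forall x, 0 <= f x)%R ->
  (0 <= fiber_average nu V f x)%R.
Proof.
move=> f0; rewrite mulr_ge0// ?invr_ge0 ?(ltW V0)//.
by rewrite fine_ge0// integral_ge0// => y _; rewrite lee_fin.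
Qed.

(** The defining property of conditional expectation; integrability of [f] makes [fine] harmless on
    every fiber. *)
Lemma integral_fiber_average (f h : T -> R) :
  measurable_fun setT f -> (forall x, 0 <= f x)%R ->
  \int[nu]_x (f x)%:E < +oo ->
  (forall x y, c x = c y -> h x = h y) -> (forall x, 0 <= h x)%R ->
  \int[nu]_x (fiber_average nu V f x * h x)%:E = \int[nu]_x (f x * h x)%:E.
Proof.
move=> mf f0 foo ch h0; have mh := measurable_fun_fiberwise ch.
have ma := measurable_fun_fiberwise (@fiber_average_fiberwise nu V f).
rewrite integral_fibers//; last 2 first.
- by apply/measurable_EFinP; exact: measurable_funM.
- by move=> x; rewrite lee_fin mulr_ge0// fiber_average_ge0.
rewrite [RHS]integral_fibers//; last 2 first.
- by apply/measurable_EFinP; exact: measurable_funM.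
- by move=> x; rewrite lee_fin mulr_ge0.
apply: eq_eseriesr => k _.
have [[x Fx]|nF] := pselect (exists x, F k x); last by rewrite !F_eq0.
have cF y : F k y -> c y = c x by move=> Fy; apply/(pcan_inj pickleK); rewrite Fy Fx.
rewrite (eq_integral (cst ((fiber_average nu V f x * h x)%:E))); last first.
  by move=> y /set_mem/cF cy; rewrite (ch _ _ cy) (fiber_average_fiberwise _ _ _ cy).
rewrite integral_cst//= [RHS](eq_integral (fun y => (h x)%:E * (f y)%:E)); last first.
  by move=> y /set_mem/cF cy; rewrite (ch _ _ cy) -EFinM mulrC.
rewrite ge0_integralZl_EFin//; last first.
- by apply/measurable_EFinP; exact: measurable_funTS.
- by move=> y _; rewrite lee_fin.
rewrite -Fx F_fiber nuV /fiber_average -EFinM.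
rewrite (mulrC _ (h x)) -mulrA mulrAC mulVf ?gt_eqF// mul1r EFinM fineK//.
rewrite ge0_fin_numE//; last by apply: integral_ge0 => y _; rewrite lee_fin.
apply: le_lt_trans foo; apply: ge0_subset_integral => //.
- by apply/measurable_EFinP.
- by move=> y _; rewrite lee_fin.
Qed.

End countable_fibers.

(** One step of Doob's inequality: [g] is the average at a new level and [M'] the new maximum. The
    difference M'^(p-1) - M^(p-1) will be constant on the new cells, so that [g] can be exchanged
    for [f] against it; this is the assumed equality of integrals. *)
Lemma doob_increment d (T : measurableType d) (R : realType)
    (nu : {measure set T -> \bar R}) (f g M M' : T -> R) (p : R) :
  1 < p -> measurable_fun setT f -> measurable_fun setT g ->
  measurable_fun setT M -> (forall x, 0 <= f x) -> (forall x, 0 <= g x) ->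
  (forall x, 0 <= M x) -> (forall x, M' x = Num.max (M x) (g x)) ->
  (\int[nu]_x (g x * (M' x `^ (p - 1) - M x `^ (p - 1)))%:E =
   \int[nu]_x (f x * (M' x `^ (p - 1) - M x `^ (p - 1)))%:E)%E ->
  (\int[nu]_x (M x `^ p)%:E <=
   (p / (p - 1))%:E * \int[nu]_x (f x * M x `^ (p - 1))%:E)%E ->
  (\int[nu]_x (M' x `^ p)%:E <=
   (p / (p - 1))%:E * \int[nu]_x (f x * M' x `^ (p - 1))%:E)%E.
Proof.
move=> p1 mf mg mM f0 g0 M0 M'E intD IH.
have c0 : 0 <= p / (p - 1) by rewrite divr_ge0//; lra.
have M'E' : M' = M \max g by apply/funext => x; rewrite M'E.
have mM' : measurable_fun setT M' by rewrite M'E'; exact: measurable_maxr.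
have mpow h r : measurable_fun setT h -> measurable_fun setT (fun x : T => h x `^ r).
  by move=> mh; exact: measurableT_comp (measurable_powR _) mh.
set D := fun x => M' x `^ (p - 1) - M x `^ (p - 1) in intD.
have D0 x : 0 <= D x.
  rewrite subr_ge0 ge0_ler_powR ?nnegrE ?subr_ge0 ?M0 ?(ltW p1)//.
    by rewrite M'E le_max M0.
  by rewrite M'E le_max lexx.
have mD : measurable_fun setT D by apply: measurable_funB; exact: mpow.
have mfM : measurable_fun setT (fun x => (f x * M x `^ (p - 1))%:E).
  by apply/measurable_EFinP; apply: measurable_funM => //; exact: mpow.
have mfD : measurable_fun setT (fun x => (f x * D x)%:E).
  by apply/measurable_EFinP; exact: measurable_funM.
have mgD : measurable_fun setT (fun x => (g x * D x)%:E).
  by apply/measurable_EFinP; exact: measurable_funM.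
have mMp : measurable_fun setT (fun x => (M x `^ p)%:E).
  by apply/measurable_EFinP; exact: mpow.
have fD0 x : (0 <= (f x * D x)%:E)%E by rewrite lee_fin mulr_ge0.
have gD0 x : (0 <= (g x * D x)%:E)%E by rewrite lee_fin mulr_ge0.
have fM0 x : (0 <= (f x * M x `^ (p - 1))%:E)%E.
  by rewrite lee_fin mulr_ge0// powR_ge0.
have Mp0 x : (0 <= (M x `^ p)%:E)%E by rewrite lee_fin powR_ge0.
have c0' : (0 <= (p / (p - 1))%:E)%E by rewrite lee_fin.
have ptw : (\int[nu]_x (M' x `^ p)%:E <= \int[nu]_x ((M x `^ p)%:E +
    (p / (p - 1))%:E * (g x * D x)%:E))%E.
  apply: ge0_le_integral => //.
  - by move=> x _; rewrite lee_fin powR_ge0.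
  - by apply/measurable_EFinP; exact: mpow.
  - by apply: emeasurable_funD => //; exact: measurable_funeM.
  - move=> x _; rewrite -EFinM -EFinD lee_fin -lerBlDl /D M'E.
    (* Where g < M the maximum is unchanged and both sides vanish; elsewhere M' = g. *)
    case: (leP (M x) (g x)) => h; last by rewrite !subrr !mulr0.
    have := powR_increment_le p1 (g0 x) (M0 x).
    have p1' : 0 < p - 1 by lra.
    by move=> ?; rewrite mulrAC ler_pdivlMr// [leLHS]mulrC.
have intMg : (\int[nu]_x ((M x `^ p)%:E + (p / (p - 1))%:E * (g x * D x)%:E) =
    \int[nu]_x (M x `^ p)%:E + (p / (p - 1))%:E * \int[nu]_x (g x * D x)%:E)%E.
  rewrite -(ge0_integralZl_EFin nu measurableT (fun x _ => gD0 x) mgD c0).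
  apply: (ge0_integralD nu measurableT (fun x _ => Mp0 x) mMp).
    by move=> x _; exact: mule_ge0.
  exact: measurable_funeM.
have intfM : (\int[nu]_x (f x * M x `^ (p - 1))%:E + \int[nu]_x (f x * D x)%:E =
    \int[nu]_x (f x * M' x `^ (p - 1))%:E)%E.
  rewrite -(ge0_integralD nu measurableT (fun x _ => fM0 x) mfM (fun x _ => fD0 x) mfD).
  apply: eq_integral => x _; by rewrite -EFinD -mulrDr /D addrC subrK.
apply: (le_trans ptw); rewrite intMg intD -intfM.
have i1 : (0 <= \int[nu]_x (f x * M x `^ (p - 1))%:E)%E by exact: integral_ge0.
have i2 : (0 <= \int[nu]_x (f x * D x)%:E)%E by exact: integral_ge0.
by rewrite (ge0_muleDr _ i1 i2); exact: leeD.
Qed.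

(** * Doob's maximal inequality and the trace inequality for nested partitions *)

Section nested_partitions.
Context d (T : measurableType d) (R : realType) (I : countType).
Variables (c : nat -> T -> I) (nu : {measure set T -> \bar R}) (V : nat -> R).
Hypothesis mc : forall k i, measurable (c k @^-1` [set i]).
Hypothesis nested : forall k x y, c k.+1 x = c k.+1 y -> c k x = c k y.
Hypothesis V0 : forall k, 0 < V k.
Hypothesis nuV : forall k x, nu (c k @^-1` [set c k x]) = (V k)%:E.

Local Notation avg k := (fiber_average (c k) nu (V k)).

Fixpoint partition_max (f : T -> R) (k : nat) (x : T) : R :=
  if k is k'.+1 then Num.max (partition_max f k' x) (avg k f x) else avg 0%N f x.

Lemma partition_max_fiberwise f k x y :
  c k x = c k y -> partition_max f k x = partition_max f k y.
Proof.
elim: k => [|k IH] /= xy; first exact: fiber_average_fiberwise.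
by rewrite (IH (nested xy)) (fiber_average_fiberwise _ _ _ xy).
Qed.

Lemma measurable_partition_max f k : measurable_fun setT (partition_max f k).
Proof. exact: measurable_fun_fiberwise (@partition_max_fiberwise f k). Qed.

Lemma avg_le_partition_max f k x : avg k f x <= partition_max f k x.
Proof. by case: k => [//|k] /=; rewrite le_max lexx orbT. Qed.

Lemma partition_max_ndecr f k x : partition_max f k x <= partition_max f k.+1 x.
Proof. by rewrite /= le_max lexx. Qed.

Section doob.
Variable f : T -> R.
Hypothesis mf : measurable_fun setT f.
Hypothesis f0 : forall x, 0 <= f x.
Hypothesis foo : (\int[nu]_x (f x)%:E < +oo)%E.

Lemma partition_max_ge0 k x : 0 <= partition_max f k x.
Proof.
elim: k => [|k IH] /=; first exact: fiber_average_ge0.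
by rewrite le_max IH.
Qed.

Let mM k r : measurable_fun setT (fun x => partition_max f k x `^ r).
Proof.
by apply: (measurable_fun_fiberwise (mc k)) => x y /(@partition_max_fiberwise f) ->.
Qed.

Let mavg k : measurable_fun setT (avg k f).
Proof. exact: (measurable_fun_fiberwise (mc k) (@fiber_average_fiberwise _ _ _ _ _ _ _ _)). Qed.

Local Notation M := (partition_max f).

Let integral_avg k : (\int[nu]_x (avg k f x)%:E = \int[nu]_x (f x)%:E)%E.
Proof.
have := integral_fiber_average (mc k) (V0 k) (nuV k) mf f0 foo
  (h := cst 1) (fun _ _ _ => erefl) (fun _ => ler01).
by under eq_integral do rewrite mulr1; under [in RHS]eq_integral do rewrite mulr1.
Qed.

Let integral_partition_max_lty k : (\int[nu]_x (M k x)%:E < +oo)%E.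
Proof.
elim: k => [|k IH] /=; first by rewrite integral_avg.
apply: (@le_lt_trans _ _ (\int[nu]_x ((M k x)%:E + (avg k.+1 f x)%:E)))%E.
  apply: ge0_le_integral => //.
  - by move=> x _; rewrite lee_fin (partition_max_ge0 k.+1).
  - by apply/measurable_EFinP; exact: (measurable_partition_max f k.+1).
  - apply: emeasurable_funD; apply/measurable_EFinP => //.
    exact: measurable_partition_max.
  - move=> x _; rewrite -EFinD lee_fin ge_max lerDl lerDr partition_max_ge0.
    by rewrite fiber_average_ge0.
rewrite ge0_integralD//.
- by rewrite integral_avg lte_add_pinfty.
- by move=> x _; rewrite lee_fin partition_max_ge0.
- by apply/measurable_EFinP; exact: measurable_partition_max.
- by move=> x _; rewrite lee_fin fiber_average_ge0.
- exact/measurable_EFinP.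
Qed.

Let partition_max_bounded k : exists2 B, 0 <= B & forall x, M k x <= B.
Proof.
have F0 : 0 <= fine (\int[nu]_x (f x)%:E).
  by rewrite fine_ge0// integral_ge0// => y _; rewrite lee_fin.
have avgB j x : avg j f x <= (V j)^-1 * fine (\int[nu]_x (f x)%:E).
  rewrite ler_wpM2l ?invr_ge0 ?(ltW (V0 j))//.
  have sub : (\int[nu]_(y in c j @^-1` [set c j x]) (f y)%:E <=
      \int[nu]_x (f x)%:E)%E.
    apply: ge0_subset_integral => //; first exact/measurable_EFinP.
    by move=> y _; rewrite lee_fin.
  have i0 : (0 <= \int[nu]_(y in c j @^-1` [set c j x]) (f y)%:E)%E.
    by apply: integral_ge0 => y _; rewrite lee_fin.
  apply: fine_le => //; rewrite ge0_fin_numE//.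
    exact: le_lt_trans sub foo.
  by apply: integral_ge0 => y _; rewrite lee_fin.
have W0 j : 0 <= (V j)^-1 * fine (\int[nu]_x (f x)%:E).
  by rewrite mulr_ge0// invr_ge0 ltW.
elim: k => [|k [B B0 MB]] /=; first by exists ((V 0%N)^-1 * fine (\int[nu]_x (f x)%:E)); [exact: W0|exact: avgB].
exists (B + (V k.+1)^-1 * fine (\int[nu]_x (f x)%:E)); first by rewrite addr_ge0.
move=> x; rewrite ge_max; apply/andP; split.
  by rewrite (le_trans (MB x))// lerDl.
by rewrite (le_trans (avgB _ _))// lerDr.
Qed.

(** A bound B for the maximum gives M^p <= B^(p-1) M, which is integrable. This finiteness is what
    permits the absorption in [doob_maximal]. *)
Let integral_partition_max_powR_lty k p : 1 < p ->
  (\int[nu]_x (M k x `^ p)%:E < +oo)%E.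
Proof.
move=> p1; have [B B0 MB] := partition_max_bounded k.
apply: (@le_lt_trans _ _ (\int[nu]_x ((B `^ (p - 1))%:E * (M k x)%:E)))%E.
  apply: ge0_le_integral => //.
  - by move=> x _; rewrite lee_fin powR_ge0.
  - exact/measurable_EFinP.
  - by apply: measurable_funeM; apply/measurable_EFinP; exact: measurable_partition_max.
  - move=> x _; rewrite -EFinM lee_fin -(@mulr_powRB1 _ (M k x)) ?partition_max_ge0//; last lra.
    rewrite mulrC ler_wpM2r ?partition_max_ge0// ge0_ler_powR// ?nnegrE ?partition_max_ge0//.
    by rewrite subr_ge0 ltW.
rewrite ge0_integralZl_EFin ?powR_ge0//.
- by rewrite lte_mul_pinfty ?lee_fin ?powR_ge0.
- by move=> x _; rewrite lee_fin partition_max_ge0.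
- by apply/measurable_EFinP; exact: measurable_partition_max.
Qed.

(** Induction over the levels. At level 0 the maximum is the average itself, which integrates
    against M^(p-1) like [f], and p/(p-1) >= 1. *)
Let doob_weak k p : 1 < p ->
  (\int[nu]_x (M k x `^ p)%:E <=
   (p / (p - 1))%:E * \int[nu]_x (f x * M k x `^ (p - 1))%:E)%E.
Proof.
move=> p1; have p0 : 0 < p by lra.
have c0 : 0 <= p / (p - 1) by rewrite divr_ge0//; lra.
have mfM j : measurable_fun setT (fun x => (f x * M j x `^ (p - 1))%:E).
  by apply/measurable_EFinP; exact: measurable_funM.
have fM0 j x : (0 <= (f x * M j x `^ (p - 1))%:E)%E.
  by rewrite lee_fin mulr_ge0// powR_ge0.
elim: k => [|k IH].
  have cM x y : c 0%N x = c 0%N y -> M 0%N x `^ (p - 1) = M 0%N y `^ (p - 1).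
    by move/(@partition_max_fiberwise f 0%N) ->.
  rewrite -(integral_fiber_average (mc 0%N) (V0 0%N) (nuV 0%N) mf f0 foo cM
    (fun x => powR_ge0 _ _)).
  have -> : (\int[nu]_x (avg 0%N f x * M 0%N x `^ (p - 1))%:E =
             \int[nu]_x (M 0%N x `^ p)%:E)%E.
    by apply: eq_integral => x _ /=; rewrite mulr_powRB1// fiber_average_ge0.
  rewrite lee_pemull//; first by apply: integral_ge0 => x _; rewrite lee_fin powR_ge0.
  by rewrite lee_fin ler_pdivlMr; lra.
have mono x : M k x `^ (p - 1) <= M k.+1 x `^ (p - 1).
  by rewrite ge0_ler_powR ?nnegrE ?partition_max_ge0 ?partition_max_ndecr ?subr_ge0 ?ltW.
apply: (@doob_increment _ _ _ nu f (avg k.+1 f) (M k)) => //.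
- exact: measurable_partition_max.
- by move=> x; exact: fiber_average_ge0.
- exact: partition_max_ge0.
- apply: (integral_fiber_average (mc k.+1) (V0 k.+1) (nuV k.+1) mf f0 foo).
    move=> x y xy; rewrite (@partition_max_fiberwise f _ _ _ xy).
    by rewrite (@partition_max_fiberwise f _ _ _ (nested xy)).
  by move=> x; rewrite subr_ge0 mono.
Qed.

(** Split f M^(p-1) with parameter e = (2p/(p-1))^(-1): the term in M^p then has coefficient 1/2 and
    is absorbed on the left. *)
Lemma doob_maximal k p : 1 < p ->
  (\int[nu]_x (partition_max f k x `^ p)%:E <=
   (2 * (p / (p - 1)) * (2 * (p / (p - 1)))^-1 `^ (1 - p))%:E *
   \int[nu]_x (f x `^ p)%:E)%E.
Proof.
move=> p1; set C := p / (p - 1).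
have C0 : 0 < C by rewrite divr_gt0; lra.
set e := (2 * C)^-1; have e0 : 0 < e by rewrite invr_gt0 mulr_gt0.
have X0 : (0 <= \int[nu]_x (f x `^ p)%:E)%E.
  by apply: integral_ge0 => x _; rewrite lee_fin powR_ge0.
have mfp : measurable_fun setT (fun x => (f x `^ p)%:E).
  by apply/measurable_EFinP; exact: measurableT_comp (measurable_powR _) mf.
have split_le : (\int[nu]_x (f x * M k x `^ (p - 1))%:E <=
    e%:E * \int[nu]_x (M k x `^ p)%:E +
    (e `^ (1 - p))%:E * \int[nu]_x (f x `^ p)%:E)%E.
  rewrite -!ge0_integralZl_EFin ?powR_ge0 ?(ltW e0)//; last 3 first.
  - by move=> x _; rewrite lee_fin powR_ge0.
  - by move=> x _; rewrite lee_fin powR_ge0.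
  - exact/measurable_EFinP.
  rewrite -ge0_integralD//; last 4 first.
  - by move=> x _; rewrite mule_ge0 ?lee_fin ?powR_ge0 ?(ltW e0).
  - by apply: measurable_funeM; exact/measurable_EFinP.
  - by move=> x _; rewrite mule_ge0 ?lee_fin ?powR_ge0 ?(ltW e0).
  - exact: measurable_funeM.
  apply: ge0_le_integral => //.
  - by move=> x _; rewrite lee_fin mulr_ge0// powR_ge0.
  - by apply/measurable_EFinP; exact: measurable_funM.
  - apply: emeasurable_funD; last exact: measurable_funeM.
    by apply: measurable_funeM; exact/measurable_EFinP.
  - move=> x _; rewrite -!EFinM -EFinD lee_fin mulr_powRB1_split//.
    exact: partition_max_ge0.
have := doob_weak k p1; rewrite -/C.
have := integral_partition_max_powR_lty k p1.
move: split_le.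
have : (0 <= \int[nu]_x (M k x `^ p)%:E)%E.
  by apply: integral_ge0 => x _; rewrite lee_fin powR_ge0.
case: (\int[nu]_x (M k x `^ p)%:E)%E => [y||]// y0 split_le _ weak.
have := le_trans weak (lee_wpmul2l (ltW (C0 : (0 < C%:E)%E)) split_le).
case: (\int[nu]_x (f x `^ p)%:E)%E X0 => [z||]// z0; last first.
  move=> _; rewrite gt0_muley ?leey// lte_fin mulr_gt0 ?powR_gt0//.
  by rewrite mulr_gt0.
rewrite -(EFinM e y) -(EFinM _ z) -EFinD -(EFinM C) -EFinM !lee_fin.
have -> : C * (e * y + e `^ (1 - p) * z) = y / 2 + C * e `^ (1 - p) * z.
  by rewrite /e; field; rewrite gt_eqF.
move: (e `^ _) => w; lra.
Qed.

End doob.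

Lemma le_integral_geometric_sum (mu : {measure set T -> \bar R}) (A l : R)
    (a : nat -> T -> R) (K : nat) :
  0 < l -> l < 1 -> 0 <= A ->
  (forall k x, (l ^+ k)%:E * mu (c k @^-1` [set c k x]) <=
    A%:E * nu (c k @^-1` [set c k x]))%E ->
  (forall k x, 0 <= a k x) -> (forall k x, a k x <= a k.+1 x) ->
  (forall k x y, c k x = c k y -> a k x = a k y) ->
  (\int[mu]_x (\sum_(k < K.+1) l ^+ k * a k x)%:E <=
   (A / (1 - l))%:E * \int[nu]_x (a K x)%:E)%E.
Proof.
move=> l0 l1 A0 munu a0 aS ca.
have ma k : measurable_fun setT (a k) by exact: measurable_fun_fiberwise (ca k).
have l1' : 0 < 1 - l by lra.
pose D i x := l ^+ i.+1 * (a i.+1 x - a i x).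
have D0 i x : 0 <= D i x by rewrite mulr_ge0 ?exprn_ge0 ?subr_ge0 ?(ltW l0).
have cD i x y : c i.+1 x = c i.+1 y -> D i x = D i y.
  by move=> xy; rewrite /D (ca _ _ _ xy) (ca _ _ _ (nested xy)).
have mD i : measurable_fun setT (D i) by exact: measurable_fun_fiberwise (cD i).
have munu' k x : (mu (c k @^-1` [set c k x]) <=
    (A / l ^+ k)%:E * nu (c k @^-1` [set c k x]))%E.
  have lk : 0 < l ^+ k by rewrite exprn_gt0.
  by rewrite EFinM (muleC A%:E) -muleA lee_pdivlMl.
(* The increment from level J to J+1 is constant on cells of level J+1 and carries the weight
   l^(J+1), exactly the pair for which [mu] is compared with [nu]. *)
have main J : (\int[mu]_x (a 0%N x + \sum_(i < J) D i x)%:E <=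
    A%:E * \int[nu]_x (a J x)%:E)%E.
  elim: J => [|J IH].
    under eq_integral do rewrite big_ord0 addr0.
    apply: (le_integral_fiberwise (mc 0%N)) => //.
    - by move=> x; have := munu' 0%N x; rewrite expr0 divr1.
    - by move=> x y /ca ->.
    - by move=> x; rewrite lee_fin.
  under eq_integral do rewrite big_ord_recr/= addrA EFinD.
  rewrite ge0_integralD//; last 4 first.
  - by move=> x _; rewrite lee_fin addr_ge0// sumr_ge0.
  - by apply/measurable_EFinP; apply: measurable_funD => //; exact: measurable_sum.
  - by move=> x _; rewrite lee_fin.
  - exact/measurable_EFinP.
  apply: (@le_trans _ _ (A%:E * \int[nu]_x (a J x)%:E +
      A%:E * \int[nu]_x (a J.+1 x - a J x)%:E))%E.
    apply: leeD => //; under eq_integral do rewrite EFinM.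
    rewrite ge0_integralZl_EFin ?exprn_ge0 ?(ltW l0)//; last 2 first.
    - by move=> x _; rewrite lee_fin subr_ge0.
    - by apply/measurable_EFinP; exact: measurable_funB.
    rewrite muleC -lee_pdivlMr ?exprn_gt0// muleAC -EFinM.
    apply: (le_integral_fiberwise (mc J.+1)) => //.
    - by rewrite divr_ge0// exprn_ge0// ltW.
    - by move=> x y xy; rewrite (ca _ _ _ xy) (ca _ _ _ (nested xy)).
    - by move=> x; rewrite lee_fin subr_ge0.
  have i1 : (0 <= \int[nu]_x (a J x)%:E)%E.
    by apply: integral_ge0 => x _; rewrite lee_fin.
  have i2 : (0 <= \int[nu]_x (a J.+1 x - a J x)%:E)%E.
    by apply: integral_ge0 => x _; rewrite lee_fin subr_ge0.
  rewrite -(ge0_muleDr _ i1 i2) lee_wpmul2l ?lee_fin//.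
  rewrite -ge0_integralD//; last 4 first.
  - by move=> x _; rewrite lee_fin.
  - exact/measurable_EFinP.
  - by move=> x _; rewrite lee_fin subr_ge0.
  - by apply/measurable_EFinP; exact: measurable_funB.
  rewrite le_eqVlt; apply/orP; left; apply/eqP.
  by apply: eq_integral => x _; rewrite -EFinD addrC subrK.
(* The factor 1/(1-l) comes from summation by parts, whose negative boundary term is discarded. *)
rewrite EFinM muleAC -lee_pdivrMr ?invr_gt0// invrK.
rewrite muleC -ge0_integralZl_EFin ?(ltW l1')//; last 2 first.
- by move=> x _; rewrite lee_fin sumr_ge0// => i _; rewrite mulr_ge0 ?exprn_ge0// ltW.
- by apply/measurable_EFinP; apply: measurable_sum => i; exact: measurable_funM.
apply: le_trans (main K); apply: ge0_le_integral => //.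
- move=> x _; rewrite mule_ge0// lee_fin ?(ltW l1')//.
  by rewrite sumr_ge0// => i _; rewrite mulr_ge0 ?exprn_ge0// ltW.
- apply: measurable_funeM; apply/measurable_EFinP; apply: measurable_sum => i.
  exact: measurable_funM.
- by apply/measurable_EFinP; apply: measurable_funD => //; exact: measurable_sum.
- move=> x _; rewrite -EFinM lee_fin (abel_geometric_sum l (a ^~ x)) gerBl.
  by rewrite mulr_ge0 ?exprn_ge0// ltW.
Qed.

(** The majorants [G] are positive, so that one may divide by them: Hoelder's inequality becomes the
    pointwise bound of a product by a sum, for the quotients M_j^(P_j)/G_j with weights p/P_j. *)
Lemma trace_inequality (mu : {measure set T -> \bar R}) (A l : R) (m : nat)
    (p : R) (P G : 'I_m -> R) (f : 'I_m -> T -> R) (K : nat) :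
  0 < l -> l < 1 -> 0 <= A ->
  (forall k x, (l ^+ k)%:E * mu (c k @^-1` [set c k x]) <=
    A%:E * nu (c k @^-1` [set c k x]))%E ->
  0 < p -> (forall j, 1 < P j) -> \sum_j p / P j = 1 ->
  (forall j, measurable_fun setT (f j)) -> (forall j x, 0 <= f j x) ->
  (forall j, \int[nu]_x (f j x)%:E < +oo)%E ->
  (forall j, 0 < G j) ->
  (forall j, \int[nu]_x (f j x `^ P j)%:E <= (G j)%:E)%E ->
  (\int[mu]_x (\sum_(k < K.+1) l ^+ k * (\prod_j avg k (f j) x) `^ p)%:E <=
   (A / (1 - l) * \prod_j G j `^ (p / P j) *
    \sum_j (2 * (P j / (P j - 1)) * (2 * (P j / (P j - 1)))^-1 `^ (1 - P j)))%:E)%E.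
Proof.
move=> l0 l1 A0 munu p0 P1 pP mf f0 foo G0 fG.
set Dj := fun j => 2 * (P j / (P j - 1)) * (2 * (P j / (P j - 1)))^-1 `^ (1 - P j).
pose a k x := (\prod_j partition_max (f j) k x) `^ p.
have M0 j k x : 0 <= partition_max (f j) k x by exact: partition_max_ge0.
have ca k x y : c k x = c k y -> a k x = a k y.
  move=> xy; rewrite /a; congr (_ `^ _); apply: eq_bigr => j _.
  exact: partition_max_fiberwise.
have ma k : measurable_fun setT (a k) by exact: measurable_fun_fiberwise (ca k).
have avg0 j k x : 0 <= avg k (f j) x by exact: fiber_average_ge0.
apply: (@le_trans _ _ (\int[mu]_x (\sum_(k < K.+1) l ^+ k * a k x)%:E)%E).
  apply: ge0_le_integral => //.
  - move=> x _; rewrite lee_fin sumr_ge0// => k _.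
    by rewrite mulr_ge0 ?powR_ge0// exprn_ge0// ltW.
  - apply/measurable_EFinP; apply: measurable_sum => k; apply: measurable_funM => //.
    apply: (measurable_fun_fiberwise (mc k)) => x y xy; congr (_ `^ _).
    by apply: eq_bigr => j _; exact: fiber_average_fiberwise.
  - apply/measurable_EFinP; apply: measurable_sum => k; exact: measurable_funM.
  - move=> x _; rewrite lee_fin; apply: ler_sum => k _.
    rewrite ler_wpM2l ?exprn_ge0 ?(ltW l0)// /a ge0_ler_powR ?(ltW p0)//.
    + by rewrite nnegrE prodr_ge0.
    + by rewrite nnegrE prodr_ge0.
    + by apply: ler_prod => j _; rewrite avg0 avg_le_partition_max.
apply: (le_trans (le_integral_geometric_sum K l0 l1 A0 munu _ _ ca)).
- by move=> k x; rewrite powR_ge0.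
- move=> k x; rewrite /a ge0_ler_powR ?(ltW p0)//.
  + by rewrite nnegrE prodr_ge0.
  + by rewrite nnegrE prodr_ge0.
  + by apply: ler_prod => j _; rewrite M0 partition_max_ndecr.
rewrite -[X in (_ <= X%:E)%E]mulrA [leRHS]EFinM lee_wpmul2l//.
  by rewrite lee_fin divr_ge0//; lra.
have PG0 : 0 <= \prod_j G j `^ (p / P j) by rewrite prodr_ge0// => j _; rewrite powR_ge0.
have Pn0 j : P j != 0 by rewrite gt_eqF//; have := P1 j; lra.
apply: (@le_trans _ _ (\int[nu]_x ((\prod_j G j `^ (p / P j))%:E *
   \sum_j ((G j)^-1%:E * (partition_max (f j) K x `^ P j)%:E))))%E.
  apply: ge0_le_integral => //.
  - by move=> x _; rewrite lee_fin powR_ge0.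
  - exact/measurable_EFinP.
  - apply: measurable_funeM; apply: emeasurable_sum => j; apply: measurable_funeM.
    apply/measurable_EFinP; apply: (measurable_fun_fiberwise (mc K)) => x y.
    by move/(@partition_max_fiberwise (f j)) ->.
  - move=> x _; rewrite (eq_bigr
      (fun j => ((G j)^-1 * partition_max (f j) K x `^ P j)%:E))//.
    rewrite sumEFin -EFinM lee_fin.
    have := @prod_powR_le_sum R m (fun j => p / P j)
      (fun j => (G j)^-1 * partition_max (f j) K x `^ P j).
    move=> /(_ _ pP _)/(ler_wpM2l PG0)H; apply: le_trans (H _ _); last 2 first.
    + by move=> j; rewrite divr_gt0//; have := P1 j; lra.
    + by move=> j; rewrite mulr_ge0 ?powR_ge0// invr_ge0 ltW.
    rewrite -big_split/= /a le_eqVlt; apply/orP; left; apply/eqP.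
    rewrite powR_prod//.
    apply: eq_bigr => j _.
    rewrite powRM ?invr_ge0 ?(ltW (G0 j)) ?powR_ge0// mulrA -powRM ?invr_ge0 ?(ltW (G0 j))//.
    by rewrite divff ?gt_eqF// powR1 mul1r -powRrM mulrCA divff// mulr1.
have mP j : measurable_fun setT (fun x => (partition_max (f j) K x `^ P j)%:E).
  apply/measurable_EFinP; apply: (measurable_fun_fiberwise (mc K)) => x y.
  by move/(@partition_max_fiberwise (f j)) ->.
have Gi0 j : (0 <= (G j)^-1%:E)%E by rewrite lee_fin invr_ge0 ltW.
have t0 j x : (0 <= (G j)^-1%:E * (partition_max (f j) K x `^ P j)%:E)%E.
  by rewrite mule_ge0// lee_fin powR_ge0.
rewrite ge0_integralZl_EFin//; last 2 first.
- by move=> x _; exact: sume_ge0.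
- by apply: emeasurable_sum => j; exact: measurable_funeM.
rewrite EFinM lee_wpmul2l// ge0_integral_sum//; last first.
  by move=> j; exact: measurable_funeM.
rewrite -sumEFin; apply: lee_sum => j _.
rewrite ge0_integralZl//; last by move=> x _; rewrite lee_fin powR_ge0.
rewrite lee_pdivrMl//; apply: (le_trans (doob_maximal (mf j) (f0 j) (foo j) K (P1 j))).
rewrite -/(Dj j) muleC lee_wpmul2r// lee_fin /Dj !mulr_ge0 ?powR_ge0 ?invr_ge0//.
  by have := P1 j; lra.
by have := P1 j; lra.
Qed.

End nested_partitions.

(** * Integration and dyadic grids in Euclidean space *)

(* The integral of a nonnegative function is a supremum over simple functions
   below it, hence monotone without any measurability. *)
Lemma ge0_le_integral_lower d (T : measurableType d) (R : realType)
    (mu : {measure set T -> \bar R}) (D : set T) (f g : T -> \bar R) :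
  (forall x, D x -> 0 <= f x)%E -> (forall x, D x -> f x <= g x)%E ->
  (\int[mu]_(x in D) f x <= \int[mu]_(x in D) g x)%E.
Proof.
move=> f0 fg; have g0 x : D x -> (0 <= g x)%E.
  by move=> Dx; exact: le_trans (f0 x Dx) (fg x Dx).
rewrite !ge0_integralE//; apply: le_ereal_sup => _ [h hf <-]; exists h => // x.
apply: le_trans (hf x) _; rewrite /patch; case: ifPn => //.
by rewrite inE; exact: fg.
Qed.

(** The positive and negative parts are each at most |f|. Without measurability their integrals
    cannot be added up to that of |f|, hence the factor 2. *)
Lemma abse_integral_le_lower d (T : measurableType d) (R : realType)
    (mu : {measure set T -> \bar R}) (f : T -> \bar R) :
  (`|\int[mu]_x f x| <= 2%:E * \int[mu]_x `|f x|)%E.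
Proof.
have i0 : (0 <= \int[mu]_x f^\+ x)%E by exact: integral_ge0.
have i1 : (0 <= \int[mu]_x f^\- x)%E by exact: integral_ge0.
rewrite integralE; apply: (le_trans (lee_abs_sub _ _)).
rewrite (gee0_abs i0) (gee0_abs i1).
have le1 : (\int[mu]_x f^\+ x <= \int[mu]_x `|f x|)%E.
  apply: ge0_le_integral_lower => // x _.
  by rewrite funeposE ge_max lee_abs abse_ge0.
have le2 : (\int[mu]_x f^\- x <= \int[mu]_x `|f x|)%E.
  apply: ge0_le_integral_lower => // x _.
  by rewrite funenegE ge_max -(abseN (f x)) lee_abs abse_ge0.
by rewrite mule_natl mule2n; exact: leeD.
Qed.

Lemma integral_tuple_measure_prod d (T : measurableType d) (R : realType)
    (mu : {sigma_finite_measure set T -> \bar R}) (m : nat) (g : 'I_m -> T -> R) :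
  (forall j, measurable_fun setT (g j)) -> (forall j x, 0 <= g j x) ->
  (\int[tuple_measure mu m]_y (\prod_(j < m) g j (tnth y j))%:E =
   \prod_(j < m) \int[mu]_x (g j x)%:E)%E.
Proof.
have mprod k (h : 'I_k -> T -> R) : (forall j, measurable_fun setT (h j)) ->
    measurable_fun setT (fun y : k.-tuple T => (\prod_(j < k) h j (tnth y j))%:E).
  move=> mh; apply/measurable_EFinP; apply: measurable_prod => j _.
  exact: measurableT_comp (mh j) (measurable_tnth j).
elim: m g => [|m IH] g mg g0.
  rewrite big_ord0; under eq_integral do rewrite big_ord0.
  by rewrite /= integral_dirac//= diracT mul1e.
have P0 (y : m.+1.-tuple T) : (0 <= (\prod_(j < m.+1) g j (tnth y j))%:E)%E.
  by rewrite lee_fin prodr_ge0.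
have Q0 (y : m.-tuple T) :
    (0 <= (\prod_(j < m) g (lift ord0 j) (tnth y j))%:E)%E.
  by rewrite lee_fin prodr_ge0.
have mQ := mprod _ (fun j => g (lift ord0 j)) (fun j => mg (lift ord0 j)).
have i0 : (0 <= \int[tuple_measure mu m]_y
    (\prod_(j < m) g (lift ord0 j) (tnth y j))%:E)%E by exact: integral_ge0.
transitivity (\int[mu \x tuple_measure mu m]_z
    (\prod_(j < m.+1) g j (tnth (tcons z) j))%:E)%E.
  have := @ge0_integral_pushforward _ _ _ _ R _ (@measurable_tcons _ T m)
    (mu \x tuple_measure mu m)%E setT _ measurableT (mprod _ g mg)
    (fun y _ => P0 y).
  by rewrite preimage_setT.
have tE (x : T) (y : m.-tuple T) : \prod_(j < m.+1) g j (tnth (tcons (x, y)) j) =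
    g ord0 x * \prod_(j < m) g (lift ord0 j) (tnth y j).
  rewrite big_ord_recl; congr (_ * _); apply: eq_bigr => j _.
  by rewrite /tcons/= tnthS.
have mtc : measurable_fun setT (fun z : T * m.-tuple T =>
    (\prod_(j < m.+1) g j (tnth (tcons z) j))%:E).
  exact: (measurableT_comp (mprod _ g mg) (@measurable_tcons _ T m)).
rewrite (fubini_tonelli1 _ mtc (fun z => P0 (tcons z))).
rewrite /fubini_F big_ord_recl -IH//.
transitivity (\int[mu]_x ((g ord0 x)%:E * \int[tuple_measure mu m]_y
    (\prod_(j < m) g (lift ord0 j) (tnth y j))%:E))%E.
  apply: eq_integral => x _.
  under eq_integral do rewrite tE EFinM.
  by rewrite (ge0_integralZl_EFin _ measurableT (fun y _ => Q0 y) mQ).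
rewrite ge0_integralZr//; first exact/measurable_EFinP.
by move=> x _; rewrite lee_fin.
Qed.

Section euclidean_geometry.
Context {R : realType} {n : nat}.
Local Notation E := (euclid R n).
Local Notation leb := (@leb R n).
Implicit Types (x y a : E) (A : 'I_n -> set R).

Lemma measurable_box A :
  (forall i, measurable (A i : set (measurableTypeR R))) ->
  measurable [set x : E | forall i, A i (tnth x i)].
Proof.
move=> mA; rewrite (_ : mkset _ = \big[setI/setT]_(i < n)
    ((fun x : n.-tuple (measurableTypeR R) => tnth x i) @^-1` A i)).
  apply: bigsetI_measurable => i _; rewrite -[X in measurable X]setTI.
  exact: (measurable_tnth i measurableT (mA i)).
by rewrite -bigcap_seq; apply/seteqP; split => [t + i _|t + i]; apply => //=;
  rewrite mem_index_enum.
Qed.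

Lemma leb_box A : (forall i, measurable (A i : set (measurableTypeR R))) ->
  (leb [set x : E | forall i, A i (tnth x i)] =
   \prod_(i < n) (@lebesgue_measure R) (A i))%E.
Proof. by move=> mA; rewrite /Defs.leb tuple_measure_box. Qed.

Lemma prod_cst_EFin (l : R) : (\prod_(i < n) l%:E = (l ^+ n)%:E)%E.
Proof.
elim: n => [|k IH]; first by rewrite big_ord0.
by rewrite big_ord_recr/= IH -EFinM exprSr.
Qed.

Lemma cubeE a (l : R) :
  cube a l = [set x | forall i,
    [set` `[(tnth a i : R), (tnth a i : R) + l]] (tnth x i : R)].
Proof.
by apply/seteqP; split => x /= H i; have := H i; rewrite in_itv.
Qed.

Lemma measurable_cube a l : measurable (cube a l).
Proof.
rewrite cubeE.
by apply: (@measurable_box (fun i => [set` `[(tnth a i : R), (tnth a i : R) + l]])).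
Qed.

Lemma leb_cube a l : 0 < l -> leb (cube a l) = (l ^+ n)%:E.
Proof.
move=> l0; rewrite cubeE (@leb_box (fun i => [set` `[(tnth a i : R), (tnth a i : R) + l]]))//.
rewrite -prod_cst_EFin; apply: eq_bigr => i _.
by rewrite lebesgue_measure_itv/= lte_fin ltrDl l0 -EFinB addrAC subrr add0r.
Qed.

Lemma vol_cube a l : 0 < l -> vol (cube a l) = l ^+ n.
Proof. by move=> l0; rewrite /vol leb_cube. Qed.

Lemma side_cube a l : (0 < n)%N -> 0 < l -> side (cube a l) = l.
Proof.
move=> n0 l0; rewrite /side vol_cube// -powR_mulrn ?(ltW l0)// -powRrM divff.
  by rewrite powRr1// ltW.
by rewrite pnatr_eq0 -lt0n.
Qed.

Definition open_cube x (r : R) : set E :=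
  [set y | forall i, `|(tnth x i : R) - tnth y i| < r].

Lemma measurable_open_cube x r : measurable (open_cube x r).
Proof.
rewrite (_ : open_cube x r = [set y | forall i,
    [set` `](tnth x i : R) - r, (tnth x i : R) + r[] (tnth y i : R)]).
  by apply: (@measurable_box
    (fun i => [set` `](tnth x i : R) - r, (tnth x i : R) + r[])).
by apply/seteqP; split => y /= H i; have := H i;
  rewrite in_itv/= ltr_norml => /andP[? ?]; apply/andP; split; lra.
Qed.

Definition euclid_shift (a : E) (s : R) : E := [tuple (tnth a i : R) + s | i < n].

Lemma tnth_euclid_shift a s i : tnth (euclid_shift a s) i = (tnth a i : R) + s.
Proof. by rewrite tnth_mktuple. Qed.

Lemma open_cube_sub_cube x r : open_cube x r `<=` cube (euclid_shift x (- r)) (2 * r).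
Proof.
move=> y H i; rewrite tnth_euclid_shift; have := H i.
by rewrite ltr_norml => /andP[? ?]; apply/andP; split; lra.
Qed.

(** Label of the half-open cell of side [s] containing [x], in the grid with a vertex at [b]. The
    labels form a countable type, as the partition lemmas require. *)
Definition grid_index (b : 'I_n -> R) (s : R) x : {ffun 'I_n -> int} :=
  [ffun i => Num.floor (((tnth x i : R) - b i) / s)].

Lemma grid_cellE (b : 'I_n -> R) (s : R) (z : {ffun 'I_n -> int}) : 0 < s ->
  grid_index b s @^-1` [set z] =
  [set x | forall i, [set` `[b i + (z i)%:~R * s, b i + (z i)%:~R * s + s[]
    (tnth x i : R)].
Proof.
move=> s0; apply/seteqP; split => x /=.
  move=> <- i; rewrite ffunE in_itv/=.
  have := floor_itv (((tnth x i : R) - b i) / s).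
  rewrite ler_pdivlMr// ltr_pdivrMr//; move: (Num.floor _) => w.
  rewrite intrD mulrDl mulr1z mul1r => /andP[? ?].
  by apply/andP; split; lra.
move=> H; apply/ffunP => i; rewrite ffunE; apply: floor_def.
have := H i; rewrite /= in_itv/= ler_pdivlMr// ltr_pdivrMr// intrD mulrDl mulr1z mul1r.
by move=> /andP[? ?]; apply/andP; split; lra.
Qed.

Lemma measurable_grid_cell b s z : 0 < s -> measurable (grid_index b s @^-1` [set z]).
Proof.
move=> s0; rewrite grid_cellE//.
by apply: (@measurable_box
  (fun i => [set` `[b i + (z i)%:~R * s, b i + (z i)%:~R * s + s[])).
Qed.

Lemma leb_grid_cell b s z : 0 < s ->
  leb (grid_index b s @^-1` [set z]) = (s ^+ n)%:E.
Proof.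
move=> s0; rewrite grid_cellE// (@leb_box
  (fun i => [set` `[b i + (z i)%:~R * s, b i + (z i)%:~R * s + s[]))//.
rewrite -prod_cst_EFin; apply: eq_bigr => i _.
by rewrite lebesgue_measure_itv/= lte_fin ltrDl s0 -EFinB addrAC subrr add0r.
Qed.

Lemma grid_cell_sub_cube b s z : 0 < s -> exists a,
  grid_index b s @^-1` [set z] `<=` cube a s.
Proof.
move=> s0; exists [tuple b i + (z i)%:~R * s | i < n].
rewrite grid_cellE// => x H i; rewrite tnth_mktuple; have := H i.
by rewrite /= in_itv/= => /andP[-> /ltW].
Qed.

(** Both levels share the offset [b], so the coordinates double, and floor(2t) is 2 floor(t) or 2
    floor(t) + 1; hence it determines floor(t). *)
Lemma grid_nested b (l : R) k x y : 0 < l ->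
  grid_index b (l / 2 ^+ k.+1) x = grid_index b (l / 2 ^+ k.+1) y ->
  grid_index b (l / 2 ^+ k) x = grid_index b (l / 2 ^+ k) y.
Proof.
move=> l0 /ffunP H; apply/ffunP => i; have := H i; rewrite !ffunE.
have half t : t / (l / 2 ^+ k.+1) = 2 * (t / (l / 2 ^+ k)).
  by rewrite exprS; field; rewrite ?gt_eqF// exprn_gt0.
rewrite !half; move: (_ / (l / _)) (_ / (l / _)) => s t st.
set z := Num.floor s; apply: floor_def.
have /andP[zs sz] := floor_itv s.
rewrite -/z intrD in zs sz *.
have z2 : 2 * z <= Num.floor (2 * s).
  by rewrite floor_ge_int intrM; lra.
have z3 : Num.floor (2 * s) < 2 * z + 2.
  by rewrite floor_lt_int intrD intrM; lra.
rewrite -st in z2 z3.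
rewrite floor_ge_int intrM in z2; rewrite floor_lt_int intrD intrM in z3.
by apply/andP; split; lra.
Qed.

(** The larger of the two floors lies between [s] and [t]. *)
Lemma floor_neq_between (s t : R) : Num.floor s != Num.floor t ->
  exists z : int, `|t - z%:~R| <= `|t - s|.
Proof.
move=> st; have [stl|tsl] := ltP s t.
  exists (Num.floor t).
  have lt : Num.floor s < Num.floor t by rewrite lt_neqAle st le_floor// ltW.
  have sz : s < (Num.floor t)%:~R by rewrite -floor_lt_int.
  have zt := floor_le t.
  by rewrite !ger0_norm; lra.
exists (Num.floor s).
have lt : Num.floor t < Num.floor s by rewrite lt_neqAle eq_sym st le_floor.
have sz : t < (Num.floor s)%:~R by rewrite -floor_lt_int.
have zt := floor_le s.
by rewrite !ler0_norm; lra.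
Qed.

(* One-third trick: the breakpoints of the grids [Z] and [Z + 2^k / 3] are at
   distance at least 1/3, so no window of radius 1/6 meets both. *)
Lemma one_third_trick (t : R) (k : nat) : exists sigma : bool,
  forall s, `|t - s| < 6^-1 ->
  Num.floor (s - sigma%:R * (2 ^+ k / 3)) = Num.floor (t - sigma%:R * (2 ^+ k / 3)).
Proof.
apply: contrapT => /forallNP H.
have /existsNP[s /not_implyP[sE]] := H false.
have /existsNP[s' /not_implyP[s'E]] := H true.
rewrite mul1r !mul0r !subr0.
move=> /eqP/floor_neq_between[z' z'E] /eqP/floor_neq_between[z zE].
have z1 : `|t - z%:~R| < 6^-1 by exact: le_lt_trans zE sE.
have z2 : `|t - 2 ^+ k / 3 - z'%:~R| < 6^-1.
  apply: le_lt_trans z'E _; rewrite (_ : _ - _ - _ = t - s')//; lra.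
(* The bound is 3 (1/6 + 1/6) = 1. The integer therefore vanishes, and 3 would divide a power of
   2. *)
have : `|((2 ^ k)%N%:Z - 3 * (z - z'))%:~R : R| < 1.
  have -> : ((2 ^ k)%N%:Z - 3 * (z - z'))%:~R =
      3 * ((t - z%:~R) - (t - 2 ^+ k / 3 - z'%:~R)) :> R.
    by rewrite !(intrD, intrM, intrN, mulrNz) -pmulrn natrX; field.
  rewrite normrM ger0_norm//; have := ler_normB (t - z%:~R) (t - 2 ^+ k / 3 - z'%:~R).
  lra.
rewrite -intr_norm ltrz1 -[X in _ < X]add0r ltzD1 normr_le0.
rewrite subr_eq0 => /eqP e.
have : (3 %| (2 ^ k)%N%:Z)%Z by rewrite e dvdz_mulr.
rewrite dvdzE/= => d3.
have : (3 %| 2)%N by rewrite (@Euclid_dvdX 2 k 3) in d3 => //; case/andP: d3.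
by [].
Qed.

(** The offset l/3 does not depend on [k], which keeps each shifted grid nested; in units of the
    side l/2^k it equals 2^k/3, as in [one_third_trick]. Coordinates are shifted independently,
    hence 2^n grids. *)
Lemma grid_capture (a : 'I_n -> R) (l : R) (k : nat) x : 0 < l ->
  exists sigma : {ffun 'I_n -> bool}, forall y,
  open_cube x (l / 2 ^+ k / 6) y ->
  grid_index (fun i => a i + (sigma i)%:R * (l / 3)) (l / 2 ^+ k) y =
  grid_index (fun i => a i + (sigma i)%:R * (l / 3)) (l / 2 ^+ k) x.
Proof.
move=> l0; have k0 : 0 < 2 ^+ k :> R by rewrite exprn_gt0.
pose t i := ((tnth x i : R) - a i) / (l / 2 ^+ k).
have /fin_all_exists[sigma sigmaE] i := one_third_trick (t i) k.
exists (finfun sigma) => y xy; apply/ffunP => i; rewrite !ffunE.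
have E z : (z - (a i + (sigma i)%:R * (l / 3))) / (l / 2 ^+ k) =
    (z - a i) / (l / 2 ^+ k) - (sigma i)%:R * (2 ^+ k / 3).
  by field; rewrite !gt_eqF.
rewrite !E; apply: sigmaE; rewrite /t -mulrBl opprB addrA subrK.
rewrite normrM (@ger0_norm _ (_^-1)) ?invr_ge0 ?divr_ge0 ?ltW//.
by rewrite ltr_pdivrMr ?divr_gt0// mulrC; exact: xy.
Qed.

Lemma euclid_dist_ge x y i : `|(tnth x i : R) - tnth y i| <= euclid_dist x y.
Proof.
rewrite /euclid_dist -sqrtr_sqr ler_wsqrtr// (bigD1 i)//= lerDl.
by rewrite sumr_ge0// => j _; rewrite sqr_ge0.
Qed.

Lemma euclid_dist_ge0 x y : 0 <= euclid_dist x y.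
Proof. exact: sqrtr_ge0. Qed.

End euclidean_geometry.

(** * Dyadic decomposition of the kernel *)

Lemma lee_prod_ge0 (R : realType) (m : nat) (F G : 'I_m -> \bar R) :
  (forall j, 0 <= F j)%E -> (forall j, F j <= G j)%E ->
  (\prod_j F j <= \prod_j G j)%E.
Proof.
move=> F0 FG; pose D (x y : \bar R) := ((0 <= x) && (x <= y))%E.
suff /andP[] : D (\prod_j F j)%E (\prod_j G j)%E by [].
apply: (@big_ind2 _ _ D) => [|a b c d /andP[a0 ab] /andP[c0 cd]|j _].
- by rewrite /D lee01 lexx.
- by rewrite /D mule_ge0// lee_pmul.
- by rewrite /D F0 FG.
Qed.

(** Setting [g] to +oo on [Z] keeps it measurable and preserves its integral, and [f] then lies
    below it everywhere. *)
Lemma ge0_le_integral_lower_ae d (T : measurableType d) (R : realType)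
    (mu : {measure set T -> \bar R}) (Z : set T) (f g : T -> \bar R) :
  measurable Z -> mu Z = 0%E -> measurable_fun setT g ->
  (forall x, 0 <= f x)%E -> (forall x, 0 <= g x)%E ->
  (forall x, ~ Z x -> f x <= g x)%E ->
  (\int[mu]_x f x <= \int[mu]_x g x)%E.
Proof.
move=> mZ Z0 mg f0 g0 fg.
pose h x := if x \in Z then +oo%E else g x.
have mh : measurable_fun setT h.
  apply: measurable_fun_ifT => //.
  by apply: (measurable_fun_bool true); rewrite setTI preimage_mem_true.
apply: (@le_trans _ _ (\int[mu]_x h x)%E).
  apply: ge0_le_integral_lower => // x _; rewrite /h.
  case: ifPn => [_|]; first exact: leey.
  by rewrite notin_setE; exact: fg.
rewrite le_eqVlt; apply/orP; left; apply/eqP.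
apply: ae_eq_integral => //; exists Z; split=> // x /=.
apply: contra_notP => nZ _; rewrite /h ifF//.
by apply/negbTE; rewrite notin_setE.
Qed.

Section integral_bound.
Context d (T : measurableType d) (R : realType).
Variable nu : {measure set T -> \bar R}.

Lemma integral_indicM (f : T -> R) (B : set T) : measurable B ->
  (\int[nu]_y (f y * \1_B y)%:E = \int[nu]_(y in B) (f y)%:E)%E.
Proof.
move=> mB; rewrite [RHS]integral_mkcond; apply: eq_integral => y _.
by rewrite patchE indicE; case: ifPn => yB; rewrite ?mulr1 ?mulr0.
Qed.

(** Hoelder's inequality up to a factor 2, from f <= t + t^(1-P) f^P; [t] plays the role of the mean
    of order [P] of [f] over [Q]. *)
Lemma integral_le_of_powR (f : T -> R) (Q : set T) (V P t : R) :
  measurable Q -> nu Q = V%:E -> 1 < P -> 0 < t -> 0 <= V ->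
  measurable_fun setT f -> (forall x, 0 <= f x) ->
  (\int[nu]_(y in Q) (f y `^ P)%:E <= (t `^ P * V)%:E)%E ->
  (\int[nu]_(y in Q) (f y)%:E <= (2 * (t * V))%:E)%E.
Proof.
move=> mQ QV P1 t0 V0 mf f0 fP.
have mfP : measurable_fun Q (fun y => (f y `^ P)%:E).
  apply/measurable_EFinP; apply: measurable_funTS.
  exact: measurableT_comp (measurable_powR _) mf.
have fP0 y : Q y -> (0 <= (f y `^ P)%:E)%E by rewrite lee_fin powR_ge0.
have tP0 : 0 <= t `^ (1 - P) by rewrite powR_ge0.
apply: (@le_trans _ _ (\int[nu]_(y in Q) (t%:E + (t `^ (1 - P))%:E * (f y `^ P)%:E))%E).
  apply: ge0_le_integral_lower => y _; first by rewrite lee_fin.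
  rewrite -EFinM -EFinD lee_fin.
  by have := mulr_powRB1_split P1 (f0 y) ler01 t0; rewrite !powR1 !mulr1.
rewrite (ge0_integralD nu mQ (f1 := cst t%:E)); last 4 first.
- by move=> y _; rewrite lee_fin ltW.
- exact: measurable_cst.
- by move=> y Qy; rewrite mule_ge0 ?fP0.
- exact: measurable_funeM.
rewrite (ge0_integralZl_EFin nu mQ fP0 mfP tP0) integral_cst// QV.
have := lee_wpmul2l (tP0 : (0 <= (t `^ (1 - P))%:E)%E) fP.
move=> /(leeD2l (t * V)%:E)/le_trans; apply.
rewrite -EFinM -EFinD lee_fin.
have -> : t `^ (1 - P) * (t `^ P * V) = t * V.
  rewrite mulrA -powRD; last by rewrite (gt_eqF t0) implybT.
  by rewrite subrK powRr1// ltW.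
lra.
Qed.

End integral_bound.

(* The junk value 0^-1 = 0 makes the kernel vanish at s = 0. *)
Lemma dyadic_kernel_bound (R : realType) (r c s : R) : 0 < r -> 0 < c -> 0 <= s ->
  exists k : nat,
  (s `^ c)^-1 <= 2 `^ c * ((s < r / 2 ^+ k)%R%:R * (r / 2 ^+ k) `^ (- c) +
    (s < r * 2 ^+ k.+1)%R%:R * (r * 2 ^+ k.+1) `^ (- c)).
Proof.
move=> r0 c0 s0; have p2 k : 0 < 2 ^+ k :> R by rewrite exprn_gt0.
have nonneg (b : bool) (z : R) : 0 <= b%:R * z `^ (- c).
  by rewrite mulr_ge0 ?powR_ge0.
have [->|sn0] := eqVneq s 0.
  exists 0%N; rewrite powR0 ?gt_eqF// invr0.
  by rewrite mulr_ge0 ?powR_ge0// addr_ge0.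
have {sn0}s0 : 0 < s by rewrite lt_neqAle eq_sym sn0.
have key z : 0 < z -> z <= 2 * s -> (s `^ c)^-1 <= 2 `^ c * z `^ (- c).
  move=> z0 zs; rewrite powRN ler_pdivlMr ?powR_gt0// mulrC.
  rewrite ler_pdivrMr ?powR_gt0// -powRM ?(ltW s0)//.
  apply: ge0_ler_powR; rewrite ?nnegrE ?(ltW c0) ?(ltW z0)//.
  by rewrite mulr_ge0 ?ler0n ?(ltW s0).
(* A near and a far term share the index [k]: the scale is r/2^k if s < r and r 2^(k+1) otherwise.
   Minimality of the exponent gives s < scale <= 2 s in both cases. *)
have [sr|rs] := ltP s r.
  have [N rN] : exists N, r <= s * 2 ^+ N.
    exists (Num.truncn (r / s)).+1; rewrite mulrC -ler_pdivrMr//.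
    apply: ltW; apply: lt_le_trans (truncnS_gt _) _.
    by rewrite -natrX ler_nat ltnW// ltn_expl.
  have ex : exists N, (r <= s * 2 ^+ N) by exists N.
  case: (ex_minnP ex) => -[|k] rk kmin; first by rewrite expr0 mulr1 leNgt sr in rk.
  have sk : s < r / 2 ^+ k.
    rewrite ltr_pdivlMr// ltNge; apply/negP => /kmin.
    by rewrite ltnn.
  exists k; rewrite sk mul1r mulrDr -[leLHS]addr0 lerD//.
    by apply: key; rewrite ?divr_gt0// ler_pdivrMr// -mulrA mulrCA -exprS.
  by rewrite mulr_ge0 ?powR_ge0.
have [N rN] : exists N, s < r * 2 ^+ N.
  exists (Num.truncn (s / r)).+1; rewrite mulrC -ltr_pdivrMr//.
  apply: lt_le_trans (truncnS_gt _) _.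
  by rewrite -natrX ler_nat ltnW// ltn_expl.
have ex : exists N, (s < r * 2 ^+ N) by exists N.
case: (ex_minnP ex) => -[|k] rk kmin; first by rewrite expr0 mulr1 ltNge rs in rk.
have sk : r * 2 ^+ k <= s.
  by rewrite leNgt; apply/negP => /kmin; rewrite ltnn.
exists k; rewrite rk mul1r mulrDr -[leLHS]add0r lerD//.
  by rewrite mulr_ge0 ?powR_ge0.
by apply: key; rewrite ?mulr_gt0// exprS mulrCA ler_pM2l.
Qed.

Section pointwise_bound.
Context (R : realType) (m n : nat).
Variables (P : 'I_m -> R) (g : 'I_m -> euclid R n -> R) (N e alpha : R).
Local Notation E := (euclid R n).
Local Notation leb := (@leb R n).
Hypothesis P1 : forall j, 1 < P j.
Hypotheses (mg : forall j, measurable_fun setT (g j)) (g0 : forall j x, 0 <= g j x).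
Hypothesis N0 : 0 < N.
(** The Morrey condition: for e = n/p_0 the exponent is n (1/p - 1/p_0). Positive real majorants [G]
    replace the integrals, so that one can divide by them. *)
Hypothesis gP : forall (a : E) (l : R), 0 < l -> exists G : 'I_m -> R,
  [/\ forall j, 0 < G j,
      forall j, (\int[leb]_(y in cube a l) (g j y `^ P j)%:E <= (G j)%:E)%E &
      \prod_j G j `^ (P j)^-1 <= N * l `^ (n%:R * (\sum_j (P j)^-1) - e)].

Lemma integral_cube_bound (a : E) (l : R) : 0 < l -> exists H : 'I_m -> R,
  [/\ forall j, 0 <= H j,
      forall j, (\int[leb]_(y in cube a l) (g j y)%:E <= (H j)%:E)%E &
      \prod_j H j <= 2 ^+ m * N * l `^ (m%:R * n%:R - e)].
Proof.
move=> l0; have [G [G0 intG GN]] := gP a l0.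
have V0 : 0 < l ^+ n by rewrite exprn_gt0.
(* Twice the mean of order [P j] times the volume, as in [integral_le_of_powR]. In the product the
   powers of l with exponent n/P_j cancel against those in the Morrey bound. *)
exists (fun j => 2 * ((G j / l ^+ n) `^ (P j)^-1 * l ^+ n)); split.
- by move=> j; rewrite !mulr_ge0 ?powR_ge0 ?ltW.
- move=> j; apply: integral_le_of_powR (P1 j) _ _ (mg j) (g0 j) _ => //.
  + exact: measurable_cube.
  + exact: leb_cube.
  + by rewrite powR_gt0 ?divr_gt0.
  + exact: ltW.
  + rewrite -powRrM mulVf; last by rewrite gt_eqF//; have := P1 j; lra.
    by rewrite powRr1 ?divr_ge0 ?(ltW V0) ?(ltW (G0 j))// divfK ?gt_eqF.
rewrite big_split/= big_split/= !prodr_const card_ord -[leRHS]mulrA ler_pM2l ?exprn_gt0//.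
have -> : \prod_j (G j / l ^+ n) `^ (P j)^-1 =
    \prod_j G j `^ (P j)^-1 * l `^ (- (n%:R * \sum_j (P j)^-1)).
  rewrite -mulrN -sumrN mulr_sumr.
  have -> : l `^ (\sum_j n%:R * - (P j)^-1) = \prod_j l `^ (n%:R * - (P j)^-1).
    elim/big_rec2 : _ => [|j x y _ <-]; first by rewrite powRr0.
    by rewrite powRD// (gt_eqF l0) implybT.
  rewrite -big_split/=; apply: eq_bigr => j _.
  rewrite powRM ?invr_ge0 ?(ltW V0) ?(ltW (G0 j))//; congr (_ * _).
  by rewrite mulrN powRN powRrM powR_mulrn ?(ltW l0)// -powR_inv1 ?(ltW V0)// powRAC powR_inv1// powR_ge0.
rewrite -exprM -(powR_mulrn _ (ltW l0)) -mulrA -powRD; last first.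
  by rewrite (gt_eqF l0) implybT.
set t := \sum_j (P j)^-1 in GN *.
have lE : l `^ (n%:R * t - e) * l `^ (- (n%:R * t) + (n * m)%:R) =
    l `^ (m%:R * n%:R - e).
  rewrite -powRD; last by rewrite (gt_eqF l0) implybT.
  by congr (_ `^ _); rewrite natrM; ring.
have := ler_wpM2r (powR_ge0 l (- (n%:R * t) + (n * m)%:R)) GN.
by rewrite -[leRHS]mulrA lE.
Qed.

(** The integrand cut off to B x ... x B, kept as a product of functions of one variable so that its
    integral factors. *)
Definition box_integrand (B : set E) (y : m.-tuple E) : R :=
  \prod_j (g j (tnth y j) * \1_B (tnth y j)).

Lemma box_integrand_ge0 B y : 0 <= box_integrand B y.
Proof. by rewrite prodr_ge0// => j _; rewrite mulr_ge0// indicE. Qed.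

Lemma measurable_box_integrand B : measurable B ->
  measurable_fun setT (box_integrand B).
Proof.
move=> mB; apply: measurable_prod => j _.
have mgB : measurable_fun setT (fun y => g j y * \1_B y).
  by apply: measurable_funM => //; exact: measurable_indic.
exact: measurableT_comp mgB (measurable_tnth j).
Qed.

Lemma integral_box_integrand B : measurable B ->
  (\int[tuple_measure leb m]_y (box_integrand B y)%:E =
   \prod_j \int[leb]_(y in B) (g j y)%:E)%E.
Proof.
move=> mB; rewrite (integral_tuple_measure_prod leb (g := fun j y => g j y * \1_B y)).
- by apply: eq_bigr => j _; rewrite integral_indicM.
- by move=> j; apply: measurable_funM => //; exact: measurable_indic.
- by move=> j y; rewrite mulr_ge0// indicE.
Qed.

Lemma integral_box_integrand_cube B a l : measurable B -> 0 < l ->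
  B `<=` cube a l ->
  (\int[tuple_measure leb m]_y (box_integrand B y)%:E <=
   (2 ^+ m * N * l `^ (m%:R * n%:R - e))%:E)%E.
Proof.
move=> mB l0 Bl; rewrite integral_box_integrand//.
have [H [H0 gH HN]] := integral_cube_bound a l0.
apply: (@le_trans _ _ (\prod_j (H j)%:E)%E); last by rewrite prodEFin lee_fin.
apply: lee_prod_ge0 => j; first by apply: integral_ge0 => y _; rewrite lee_fin.
apply: le_trans (gH j); apply: ge0_subset_integral => //.
- exact: measurable_cube.
- by apply/measurable_EFinP; exact: measurable_funTS.
- by move=> y _; rewrite lee_fin.
Qed.

(** The two terms of [dyadic_kernel_bound], with the condition that the sum of the distances is
    below the scale relaxed to membership of every y_j in a cube about [x]. *)
Definition kernel_term (r : R) (x : E) (k : nat) (y : m.-tuple E) : R :=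
  2 `^ (m%:R * n%:R - alpha) *
  ((r / 2 ^+ k) `^ (- (m%:R * n%:R - alpha)) *
     box_integrand (open_cube x (r / 2 ^+ k)) y +
   (r * 2 ^+ k.+1) `^ (- (m%:R * n%:R - alpha)) *
     box_integrand (open_cube x (r * 2 ^+ k.+1)) y).

Lemma kernel_term_ge0 r x k y : 0 <= kernel_term r x k y.
Proof.
by rewrite mulr_ge0 ?powR_ge0// addr_ge0// mulr_ge0 ?powR_ge0 ?box_integrand_ge0.
Qed.

Lemma measurable_kernel_term r x k : measurable_fun setT (kernel_term r x k).
Proof.
have mb B : measurable B -> measurable_fun setT (box_integrand B).
  exact: measurable_box_integrand.
apply: measurable_funM => //; apply: measurable_funD; apply: measurable_funM => //.
  by apply: mb; exact: measurable_open_cube.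
by apply: mb; exact: measurable_open_cube.
Qed.

Lemma kernel_le_kernel_term (r : R) (x : E) (y : m.-tuple E) :
  alpha < m%:R * n%:R -> 0 < r -> exists k,
  (\prod_j g j (tnth y j)) /
    (\sum_j euclid_dist x (tnth y j)) `^ (m%:R * n%:R - alpha) <=
  kernel_term r x k y.
Proof.
move=> amn r0; set s := \sum_j _; set c := _ - alpha.
have c0 : 0 < c by rewrite subr_gt0.
have d0 j : 0 <= euclid_dist x (tnth y j) by exact: euclid_dist_ge0.
have s0 : 0 <= s by exact: sumr_ge0.
have pg0 : 0 <= \prod_j g j (tnth y j) by rewrite prodr_ge0.
have [k sk] := dyadic_kernel_bound r0 c0 s0; exists k.
apply: (le_trans (ler_wpM2l pg0 sk)).
rewrite /kernel_term mulrCA ler_wpM2l ?powR_ge0//.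
have box (rho : R) : \prod_j g j (tnth y j) * (s < rho)%R%:R <=
    box_integrand (open_cube x rho) y.
  case: ltP => [sr|_]; last by rewrite mulr0 box_integrand_ge0.
  rewrite mulr1; apply: ler_prod => j _; rewrite g0/= indicE mem_set ?mulr1//.
  move=> i; apply: le_lt_trans sr; apply: le_trans (euclid_dist_ge _ _ i) _.
  by rewrite /s (bigD1 j)//= lerDl sumr_ge0.
rewrite mulrDr lerD// mulrA mulrC ler_wpM2l ?powR_ge0//.
Qed.

(** For each [y] a single term of the series dominates the kernel, hence so does the series. [F]
    will be the absolute value of the original integrand, which is controlled only off a null
    set. *)
Lemma le_integral_kernel_terms (r : R) (x : E) (Z : set (m.-tuple E))
    (F : m.-tuple E -> \bar R) :
  alpha < m%:R * n%:R -> 0 < r ->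
  measurable Z -> tuple_measure leb m Z = 0%E -> (forall y, 0 <= F y)%E ->
  (forall y, ~ Z y -> F y <= ((\prod_j g j (tnth y j)) /
    (\sum_j euclid_dist x (tnth y j)) `^ (m%:R * n%:R - alpha))%:E)%E ->
  (\int[tuple_measure leb m]_y F y <=
   \sum_(0 <= k <oo) \int[tuple_measure leb m]_y (kernel_term r x k y)%:E)%E.
Proof.
move=> amn r0 mZ Z0 F0 FZ.
have mk k : measurable_fun setT (fun y => (kernel_term r x k y)%:E).
  by apply/measurable_EFinP; exact: measurable_kernel_term.
have k0 k y : (0 <= (kernel_term r x k y)%:E)%E.
  by rewrite lee_fin kernel_term_ge0.
rewrite -(integral_nneseries (tuple_measure leb m) measurableT mk (fun k y _ => k0 k y)).
apply: (ge0_le_integral_lower_ae mZ Z0) => //.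
- by apply: ge0_emeasurable_sum => k // y _.
- by move=> y; exact: nneseries_ge0.
move=> y Zy; apply: (le_trans (FZ y Zy)).
have [k hk] := kernel_le_kernel_term x y amn r0.
apply: (@le_trans _ _ (kernel_term r x k y)%:E); first by rewrite lee_fin.
apply: le_trans (nneseries_lim_ge k.+1 _) => //.
by rewrite big_mkord big_ord_recr/= leeDr// sume_ge0.
Qed.

End pointwise_bound.

(** * The estimate on one cube *)

Lemma ge0_le_poweR (R : realType) (x y : \bar R) (s : R) :
  (0 <= s)%R -> (0 <= x)%E -> (x <= y)%E -> (x `^ s <= y `^ s)%E.
Proof.
move=> s0 x0 xy; apply: gt0_ler_poweR => //; rewrite in_itv/= leey andbT//.
exact: le_trans xy.
Qed.

Section local_estimate.
Context (R : realType) (m n : nat).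
Variables (P : 'I_m -> R) (g : 'I_m -> euclid R n -> R) (N e alpha : R).
Local Notation E := (euclid R n).
Local Notation leb := (@leb R n).
Hypotheses (P1 : forall j, 1 < P j).
Hypotheses (mg : forall j, measurable_fun setT (g j)) (g0 : forall j x, 0 <= g j x).
Hypothesis N0 : 0 < N.
Hypothesis gP : forall (a : E) (l : R), 0 < l -> exists G : 'I_m -> R,
  [/\ forall j, 0 < G j,
      forall j, (\int[leb]_(y in cube a l) (g j y `^ P j)%:E <= (G j)%:E)%E &
      \prod_j G j `^ (P j)^-1 <= N * l `^ (n%:R * (\sum_j (P j)^-1) - e)].
Hypotheses (ae : alpha < e) (e0 : 0 < e) (amn : alpha < m%:R * n%:R).
Variables (a : E) (l : R).
Hypothesis l0 : 0 < l.

(** Chosen so that the window of radius r/2^k is the one that [grid_capture] places in a cell of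
    side l/2^k. *)
Local Notation r := (l / 6).
Local Notation gamma := (m%:R * n%:R - alpha).

Let r0 : 0 < r. Proof. by rewrite divr_gt0. Qed.
Let p2 k : 0 < 2 ^+ k :> R. Proof. by rewrite exprn_gt0. Qed.
Let rk0 k : 0 < r / 2 ^+ k. Proof. by rewrite divr_gt0. Qed.
Let lk0 k : 0 < l / 2 ^+ k. Proof. by rewrite divr_gt0. Qed.

(** The concentric cube of triple side contains all windows of the near part. Cutting off there
    makes the functions integrable, as Doob's inequality requires, and keeps the Morrey bound at
    scale l. *)
Definition near_cube : set E := cube (euclid_shift a (- l)) (3 * l).
Definition near_part (j : 'I_m) (y : E) : R := g j y * \1_near_cube y.
Definition shifted_grid (sigma : {ffun 'I_n -> bool}) (k : nat) :
    E -> {ffun 'I_n -> int} :=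
  grid_index (fun i => (tnth a i : R) + (sigma i)%:R * (l / 3)) (l / 2 ^+ k).
Definition cell_volume (k : nat) : R := (l / 2 ^+ k) ^+ n.
Definition cell_average sigma k j : E -> R :=
  fiber_average (shifted_grid sigma k) leb (cell_volume k) (near_part j).
(** The capturing grid varies with [x] and [k]; the sum over all shifts covers every choice. *)
Definition dyadic_average k x : R := \sum_sigma \prod_j cell_average sigma k j x.

Lemma measurable_near_part j : measurable_fun setT (near_part j).
Proof.
by apply: measurable_funM => //; apply: measurable_indic; exact: measurable_cube.
Qed.

Lemma near_part_ge0 j y : 0 <= near_part j y.
Proof. by rewrite mulr_ge0// indicE. Qed.

Lemma near_part_le j y : near_part j y <= g j y.
Proof. by rewrite /near_part indicE; case: (_ \in _); rewrite ?mulr1 ?mulr0. Qed.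

Lemma near_part_integrable j : (\int[leb]_y (near_part j y)%:E < +oo)%E.
Proof.
rewrite integral_indicM; last exact: measurable_cube.
have l3 : 0 < 3 * l by rewrite mulr_gt0.
have [H [_ gH _]] := integral_cube_bound P1 mg g0 gP (euclid_shift a (- l)) l3.
exact: le_lt_trans (gH j) (ltry _).
Qed.

Lemma cell_volume_gt0 k : 0 < cell_volume k.
Proof. by rewrite exprn_gt0. Qed.

Lemma measurable_shifted_grid sigma k z :
  measurable (shifted_grid sigma k @^-1` [set z]).
Proof. exact: measurable_grid_cell. Qed.

Lemma leb_shifted_grid sigma k x :
  leb (shifted_grid sigma k @^-1` [set shifted_grid sigma k x]) = (cell_volume k)%:E.
Proof. exact: leb_grid_cell. Qed.

Lemma cell_average_ge0 sigma k j x : 0 <= cell_average sigma k j x.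
Proof. apply: fiber_average_ge0; [exact: cell_volume_gt0|exact: near_part_ge0]. Qed.

Lemma dyadic_average_ge0 k x : 0 <= dyadic_average k x.
Proof.
by apply: sumr_ge0 => s _; apply: prodr_ge0 => j _; exact: cell_average_ge0.
Qed.

Lemma measurable_cell_average sigma k j : measurable_fun setT (cell_average sigma k j).
Proof.
apply: (measurable_fun_fiberwise (@measurable_shifted_grid sigma k)) => x y.
exact: fiber_average_fiberwise.
Qed.

Lemma measurable_dyadic_average k : measurable_fun setT (dyadic_average k).
Proof.
apply: measurable_sum => s; apply: measurable_prod => j _.
exact: measurable_cell_average.
Qed.

Lemma cell_averageE sigma k j x :
  (\int[leb]_(y in shifted_grid sigma k @^-1` [set shifted_grid sigma k x])
     (near_part j y)%:E = (cell_volume k * cell_average sigma k j x)%:E)%E.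
Proof.
rewrite /cell_average /fiber_average mulrA divff ?gt_eqF ?cell_volume_gt0//.
rewrite mul1r fineK// ge0_fin_numE; last first.
  by apply: integral_ge0 => y _; rewrite lee_fin near_part_ge0.
apply: le_lt_trans (near_part_integrable j); apply: ge0_subset_integral => //.
- exact: measurable_shifted_grid.
- by apply/measurable_EFinP; exact: measurable_near_part.
- by move=> y _; rewrite lee_fin near_part_ge0.
Qed.

Lemma prod_cell_average_le sigma k x :
  \prod_j cell_average sigma k j x <= 2 ^+ m * N * (l / 2 ^+ k) `^ (- e).
Proof.
set Q := shifted_grid sigma k @^-1` [set shifted_grid sigma k x].
have [b Qb] : exists b, Q `<=` cube b (l / 2 ^+ k) by exact: grid_cell_sub_cube.
have [H [H0 gH HN]] := integral_cube_bound P1 mg g0 gP b (lk0 k).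
have avgH j : cell_volume k * cell_average sigma k j x <= H j.
  rewrite -lee_fin -cell_averageE; apply: le_trans (gH j).
  apply: (@le_trans _ _ (\int[leb]_(y in Q) (g j y)%:E)%E).
    apply: ge0_le_integral_lower => y _; first by rewrite lee_fin near_part_ge0.
    by rewrite lee_fin near_part_le.
  apply: ge0_subset_integral => //.
  - exact: measurable_shifted_grid.
  - exact: measurable_cube.
  - by apply/measurable_EFinP; exact: measurable_funTS.
  - by move=> y _; rewrite lee_fin.
have : \prod_j (cell_volume k * cell_average sigma k j x) <= \prod_j H j.
  apply: ler_prod => j _; rewrite avgH andbT.
  by rewrite mulr_ge0 ?cell_average_ge0 ?(ltW (cell_volume_gt0 k)).
move=> /le_trans/(_ HN); rewrite big_split/= prodr_const card_ord.
rewrite /cell_volume -exprM -(powR_mulrn _ (ltW (lk0 k))).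
have -> : m%:R * n%:R - e = (n * m)%:R + - e :> R by rewrite natrM mulrC.
rewrite powRD; last by rewrite (gt_eqF (lk0 k)) implybT.
by rewrite mulrCA ler_pM2l ?powR_gt0.
Qed.

Lemma dyadic_average_le k x :
  dyadic_average k x <= 2 ^+ (m + n) * N * (r / 2 ^+ k) `^ (- e).
Proof.
apply: (@le_trans _ _ (\sum_(sigma : {ffun 'I_n -> bool})
    2 ^+ m * N * (l / 2 ^+ k) `^ (- e))).
  by apply: ler_sum => s _; exact: prod_cell_average_le.
(* As e > 0, passing to the smaller scale increases the bound. The factor 2^m comes from
   [integral_cube_bound], and 2^n counts the grids. *)
have : r / 2 ^+ k <= l / 2 ^+ k.
  rewrite ler_pM2r ?invr_gt0// ler_pdivrMr//.
  by have := l0; lra.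
move: (rk0 k) (lk0 k); move: (r / 2 ^+ k) (l / 2 ^+ k) => s t s0 t0 st.
rewrite sumr_const card_ffun card_bool card_ord -[leLHS]mulr_natl natrX.
rewrite [2 ^+ (m + n)]exprD -!mulrA mulrCA !ler_pM2l ?p2// !powRN lef_pV2 ?posrE ?powR_gt0//.
by apply: ge0_ler_powR; rewrite ?nnegrE ?(ltW e0) ?(ltW s0) ?(ltW t0).
Qed.

Lemma integral_near_box x k : cube a l x ->
  (\int[tuple_measure leb m]_y (box_integrand g (open_cube x (r / 2 ^+ k)) y)%:E
   <= (cell_volume k ^+ m * dyadic_average k x)%:E)%E.
Proof.
move=> ax; set B := open_cube x _.
have mB : measurable B by exact: measurable_open_cube.
have BE : B = open_cube x (l / 2 ^+ k / 6) by rewrite /B mulrAC.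
have [sigma capt] := grid_capture (fun i => (tnth a i : R)) k x l0.
rewrite integral_box_integrand//.
set Q := shifted_grid sigma k @^-1` [set shifted_grid sigma k x].
have BQ : B `<=` Q by rewrite BE => y /capt.
have Bnear : B `<=` near_cube.
  move=> y By i; rewrite tnth_euclid_shift; have := By i; have := ax i.
  have rr : r / 2 ^+ k <= r by rewrite ler_piMr ?(ltW r0)// invf_le1// exprn_ege1// ler1n.
  move=> /andP[h1 h2]; rewrite ltr_norml => /andP[h3 h4].
  have := l0; move: rr h1 h2 h3 h4; move: (r / 2 ^+ k) => s; lra.
apply: (@le_trans _ _ (\prod_j (cell_volume k * cell_average sigma k j x)%:E)%E).
  apply: lee_prod_ge0 => j; first by apply: integral_ge0 => y _; rewrite lee_fin.
  rewrite -cell_averageE.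
  apply: (@le_trans _ _ (\int[leb]_(y in B) (near_part j y)%:E)%E).
    apply: ge0_le_integral_lower => y By; first by rewrite lee_fin.
    by rewrite lee_fin /near_part indicE mem_set ?mulr1//; exact: Bnear.
  apply: ge0_subset_integral => //.
  - exact: measurable_shifted_grid.
  - by apply/measurable_EFinP; apply: measurable_funTS; exact: measurable_near_part.
  - by move=> y _; rewrite lee_fin near_part_ge0.
rewrite prodEFin lee_fin big_split/= prodr_const card_ord.
apply: ler_wpM2l; first by apply: exprn_ge0; exact/ltW/cell_volume_gt0.
rewrite /dyadic_average (bigD1 sigma)//= lerDl.
by apply: sumr_ge0 => s _; apply: prodr_ge0 => j _; exact: cell_average_ge0.
Qed.

(** The factor 6^(nm) compares the m-th power of the volume of a cell of side l/2^k with that of a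
    cube of side r/2^k. *)
Definition kernel_constant : R := 2 `^ gamma * 6 ^+ (n * m).
(** The quotient bounds the geometric series of ratio 2^(alpha-e); the factor 2^(mn-e) arises
    because an open cube of radius rho lies in a cube of side 2 rho. *)
Definition far_constant : R :=
  2 `^ (m%:R * n%:R - e) * (2 `^ (alpha - e) / (1 - 2 `^ (alpha - e))).

Lemma kernel_constant_gt0 : 0 < kernel_constant.
Proof. by rewrite mulr_gt0 ?powR_gt0// exprn_gt0. Qed.

Lemma ratio_lt1 : 2 `^ (alpha - e) < 1 :> R.
Proof.
rewrite -opprB powRN invf_lt1 ?powR_gt0//.
have E1 : 1 `^ (e - alpha) = 1 :> R by rewrite powR1.
rewrite -[ltLHS]E1; apply: gt0_ltr_powR; rewrite ?nnegrE ?subr_gt0//.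
by rewrite ltr1n.
Qed.

Lemma far_constant_ge0 : 0 <= far_constant.
Proof.
by rewrite mulr_ge0 ?divr_ge0 ?powR_ge0// subr_ge0 ltW// ratio_lt1.
Qed.

Lemma integral_kernel_term_le x k : cube a l x ->
  (\int[tuple_measure leb m]_y (kernel_term g alpha r x k y)%:E <=
   (kernel_constant * ((r / 2 ^+ k) `^ alpha * dyadic_average k x +
     2 ^+ m * 2 `^ (m%:R * n%:R - e) * N * r `^ (alpha - e) *
       (2 `^ (alpha - e)) ^+ k.+1))%:E)%E.
Proof.
move=> ax; set rho := r * 2 ^+ k.+1.
have rho0 : 0 < rho by rewrite mulr_gt0.
set B := open_cube x (r / 2 ^+ k); set B' := open_cube x rho.
have mB : measurable B by exact: measurable_open_cube.
have mB' : measurable B' by exact: measurable_open_cube.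
pose bi := box_integrand g.
have mb D : measurable D -> measurable_fun setT (fun y => (bi D y)%:E).
  by move=> mD; apply/measurable_EFinP; exact: measurable_box_integrand.
have b0 D y : (0 <= (bi D y)%:E)%E by rewrite lee_fin box_integrand_ge0.
have near : (\int[tuple_measure leb m]_y (bi B y)%:E <=
    (cell_volume k ^+ m * dyadic_average k x)%:E)%E by exact: integral_near_box.
have far : (\int[tuple_measure leb m]_y (bi B' y)%:E <=
    (2 ^+ m * N * (2 * rho) `^ (m%:R * n%:R - e))%:E)%E.
  apply: (integral_box_integrand_cube P1 mg g0 gP mB' _ (@open_cube_sub_cube _ _ x rho)).
  by rewrite mulr_gt0.
set c := 2 `^ gamma; set c1 := (r / 2 ^+ k) `^ (- gamma); set c2 := rho `^ (- gamma).
have c0 : 0 <= c by rewrite powR_ge0.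
have c10 : 0 <= c1 by rewrite powR_ge0.
have c20 : 0 <= c2 by rewrite powR_ge0.
have intE : (\int[tuple_measure leb m]_y (kernel_term g alpha r x k y)%:E =
    c%:E * (c1%:E * \int[tuple_measure leb m]_y (bi B y)%:E +
            c2%:E * \int[tuple_measure leb m]_y (bi B' y)%:E))%E.
  rewrite -(ge0_integralZl_EFin _ measurableT (fun y _ => b0 B y) (mb _ mB) c10).
  rewrite -(ge0_integralZl_EFin _ measurableT (fun y _ => b0 B' y) (mb _ mB') c20).
  rewrite -ge0_integralD//; last 4 first.
  - by move=> y _; rewrite mule_ge0 ?b0.
  - by apply: measurable_funeM; exact: mb.
  - by move=> y _; rewrite mule_ge0 ?b0.
  - by apply: measurable_funeM; exact: mb.
  rewrite -(ge0_integralZl_EFin _ measurableT _ _ c0)//.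
  - by move=> y _; rewrite adde_ge0 ?mule_ge0 ?b0.
  - by apply: emeasurable_funD; apply: measurable_funeM; exact: mb.
rewrite intE.
apply: (@le_trans _ _ (c * (c1 * (cell_volume k ^+ m * dyadic_average k x) +
  c2 * (2 ^+ m * N * (2 * rho) `^ (m%:R * n%:R - e))))%:E).
  rewrite EFinM EFinD !(EFinM c1) !(EFinM c2) lee_wpmul2l//.
  by apply: leeD; rewrite lee_wpmul2l.
rewrite lee_fin /kernel_constant -/c -[leRHS]mulrA ler_wpM2l// mulrDr lerD//.
  rewrite mulrA [leRHS]mulrA ler_wpM2r ?dyadic_average_ge0//.
  have -> : cell_volume k ^+ m = 6 ^+ (n * m) * (r / 2 ^+ k) `^ (m%:R * n%:R).
    rewrite mulrC -natrM (powR_mulrn _ (ltW (rk0 k))) mulnC /cell_volume -exprM -exprMn.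
    by congr (_ ^+ _); field; rewrite gt_eqF.
  rewrite mulrCA -powRD; last by rewrite (gt_eqF (rk0 k)) implybT.
  by rewrite opprB subrK.
have c6 : 1 <= 6 ^+ (n * m) :> R by rewrite exprn_ege1// ler1n.
apply: le_trans (ler_peMl _ c6); last by rewrite !mulr_ge0 ?exprn_ge0 ?powR_ge0 ?(ltW N0).
have rE : rho `^ (alpha - e) = r `^ (alpha - e) * (2 `^ (alpha - e)) ^+ k.+1.
  rewrite /rho (powRM _ (ltW r0) (ltW (p2 _))); congr (_ * _).
  rewrite -(powR_mulrn k.+1 (powR_ge0 2 (alpha - e))) powRAC.
  by rewrite (powR_mulrn k.+1 (ler0n R 2)).
have rE' : rho `^ (alpha - e) = c2 * rho `^ (m%:R * n%:R - e).
  have -> : alpha - e = - gamma + (m%:R * n%:R - e) by ring.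
  by rewrite powRD// (gt_eqF rho0) implybT.
rewrite -[X in _ <= X]mulrA -rE rE' (powRM _ _ (ltW rho0))//.
by rewrite le_eqVlt; apply/orP; left; apply/eqP; ring.
Qed.

(** The factor 2^(m+n) N is the constant that bounds [dyadic_average]; using it here too gives the
    form demanded by [hedberg_sum]. *)
Definition far_sum : R :=
  far_constant * (2 ^+ (m + n) * N) * r `^ (alpha - e).
Definition dyadic_sum (K : nat) (x : E) : R :=
  far_sum + \sum_(k < K.+1) (r / 2 ^+ k) `^ alpha * dyadic_average k x.

Lemma far_sum_ge0 : 0 <= far_sum.
Proof.
apply: mulr_ge0 (powR_ge0 _ _); apply: mulr_ge0 far_constant_ge0 _.
by rewrite mulr_ge0 ?exprn_ge0 ?(ltW N0).
Qed.

Lemma dyadic_sum_ge0 K x : 0 <= dyadic_sum K x.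
Proof.
rewrite addr_ge0 ?far_sum_ge0// sumr_ge0// => k _.
by rewrite mulr_ge0 ?powR_ge0 ?dyadic_average_ge0.
Qed.

Lemma measurable_dyadic_sum K : measurable_fun setT (dyadic_sum K).
Proof.
apply: measurable_funD => //; apply: measurable_sum => k.
by apply: measurable_funM => //; exact: measurable_dyadic_average.
Qed.

Lemma dyadic_sum_ndecr x : {homo dyadic_sum^~ x : K K' / (K <= K')%N >-> K <= K'}.
Proof.
apply: homo_leq => [//|y1 y2 y3|K]; first exact: le_trans.
rewrite /dyadic_sum lerD2l [leRHS]big_ord_recr/= lerDl.
by rewrite mulr_ge0 ?powR_ge0 ?dyadic_average_ge0.
Qed.

Lemma geometric_sum_le (w : R) K : 0 <= w -> w < 1 ->
  \sum_(k < K) w ^+ k.+1 <= w / (1 - w).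
Proof.
move=> w0 w1; rewrite ler_pdivlMr ?subr_gt0//.
have -> : (\sum_(k < K) w ^+ k.+1) * (1 - w) = w * (1 - w ^+ K).
  elim: K => [|K IH]; first by rewrite big_ord0 mul0r expr0 subrr mulr0.
  by rewrite big_ord_recr/= mulrDl IH !exprS; ring.
by rewrite ler_piMr// gerBl exprn_ge0.
Qed.

(** The bound is a limit of q-th powers so that monotone convergence applies later. Every partial
    sum is at most the q-th root of the limit, which may be +oo. *)
Lemma powR_integral_le_lim (x : E) (q : R) (Z : set (m.-tuple E))
    (F : m.-tuple E -> \bar R) : 0 < q -> cube a l x ->
  measurable Z -> tuple_measure leb m Z = 0%E -> (forall y, 0 <= F y)%E ->
  (forall y, ~ Z y -> F y <= ((\prod_j g j (tnth y j)) /
    (\sum_j euclid_dist x (tnth y j)) `^ gamma)%:E)%E ->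
  ((\int[tuple_measure leb m]_y F y) `^ q <=
   (kernel_constant `^ q)%:E * limn (fun K => (dyadic_sum K x `^ q)%:E))%E.
Proof.
move=> q0 ax mZ Z0 F0 FZ.
set L := limn _.
have cvgL : ((dyadic_sum K x `^ q)%:E @[K --> \oo] -->
    ereal_sup (range (fun K => (dyadic_sum K x `^ q)%:E)))%E.
  apply: ereal_nondecreasing_cvgn => K K' KK'; rewrite lee_fin.
  by apply: ge0_ler_powR; rewrite ?nnegrE ?dyadic_sum_ge0 ?(ltW q0)// dyadic_sum_ndecr.
have LE : L = ereal_sup (range (fun K => (dyadic_sum K x `^ q)%:E)).
  exact/cvg_lim.
have TL K : ((dyadic_sum K x)%:E <= L `^ q^-1)%E.
  have TqL : ((dyadic_sum K x `^ q)%:E <= L)%E.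
    by rewrite LE; apply: ereal_sup_ubound; exists K.
  have Tq : ((dyadic_sum K x)%:E = (dyadic_sum K x `^ q)%:E `^ q^-1)%E.
    by rewrite poweR_EFin -powRrM divff ?gt_eqF// powRr1// dyadic_sum_ge0.
  rewrite Tq; apply: ge0_le_poweR TqL; first by rewrite invr_ge0 ltW.
  by rewrite lee_fin powR_ge0.
have L0 : (0 <= L)%E by apply: le_trans (_ : (dyadic_sum 0 x `^ q)%:E <= L)%E;
  [rewrite lee_fin powR_ge0|rewrite LE; apply: ereal_sup_ubound; exists 0%N].
have series_le : (\int[tuple_measure leb m]_y F y <=
    kernel_constant%:E * L `^ q^-1)%E.
  apply: (le_trans (le_integral_kernel_terms mg g0 amn r0 mZ Z0 F0 FZ)).
  have i0 k : (0 <= \int[tuple_measure leb m]_y (kernel_term g alpha r x k y)%:E)%E.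
    by apply: integral_ge0 => y _; rewrite lee_fin kernel_term_ge0.
  apply: lime_le; first exact: is_cvg_nneseries.
  apply: nearW => K; rewrite big_mkord.
  apply: (@le_trans _ _ (kernel_constant%:E * (dyadic_sum K x)%:E)%E); last first.
    by rewrite lee_wpmul2l ?lee_fin ?(ltW kernel_constant_gt0).
  apply: (@le_trans _ _ (\sum_(k < K) (kernel_constant *
     ((r / 2 ^+ k) `^ alpha * dyadic_average k x +
     2 ^+ m * 2 `^ (m%:R * n%:R - e) * N * r `^ (alpha - e) *
       (2 `^ (alpha - e)) ^+ k.+1))%:E)%E).
    by apply: lee_sum => k _; exact: integral_kernel_term_le.
  rewrite sumEFin -EFinM lee_fin -mulr_sumr ler_pM2l ?kernel_constant_gt0//.
  rewrite big_split/= addrC lerD//; last first.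
    by rewrite [leRHS]big_ord_recr/= lerDl mulr_ge0 ?powR_ge0 ?dyadic_average_ge0.
  rewrite -mulr_sumr.
  have := geometric_sum_le K (powR_ge0 2 (alpha - e)) ratio_lt1.
  set S := \sum_(k < K) _; set W := _ / _ => SW.
  rewrite /far_sum /far_constant -/W.
  have -> : 2 `^ (m%:R * n%:R - e) * W * (2 ^+ (m + n) * N) * r `^ (alpha - e) =
    (2 ^+ m * 2 `^ (m%:R * n%:R - e) * N * r `^ (alpha - e)) * (2 ^+ n * W).
    by rewrite exprD; ring.
  rewrite ler_wpM2l ?mulr_ge0 ?exprn_ge0 ?powR_ge0 ?(ltW N0)//.
  apply: (le_trans SW); rewrite ler_peMl ?exprn_ege1 ?ler1n//.
  by rewrite divr_ge0 ?powR_ge0// subr_ge0 ltW// ratio_lt1.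
have iF0 : (0 <= \int[tuple_measure leb m]_y F y)%E by exact: integral_ge0.
apply: (le_trans (ge0_le_poweR (ltW q0) iF0 series_le)).
rewrite poweRM ?poweR_ge0 ?lee_fin ?(ltW kernel_constant_gt0)//.
by rewrite poweR_EFin -poweRrM mulVf ?gt_eqF// poweRe1.
Qed.

(** * Integration against the measure [mu] over the fixed cube *)

Section trace.
Variables (mu : {measure set E -> \bar R}) (A p q beta C : R).
Hypotheses (A0 : 0 <= A)
  (muA : forall b s, 0 < s -> (mu (cube b s) <= (A * s `^ (n%:R - beta * p))%:E)%E).
Hypotheses (p0 : 0 < p) (p1 : p <= 1) (pq : p <= q) (beta0 : 0 < beta)
  (qp : q * (e - alpha) = p * (e - beta)) (pP : \sum_j p / P j = 1).
Hypothesis C0 : 0 < C.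
(** The conclusion of [hedberg_sum], taken as a hypothesis so that [C] is chosen once, before the
    measure, the functions and the cube. *)
Hypothesis hedberg : forall r N u S0 K, 0 < r -> 0 < N ->
    (forall k, 0 <= u k <= N * (r / 2 ^+ k) `^ (- e)) ->
    0 <= S0 <= far_constant * N * r `^ (alpha - e) ->
    (S0 + \sum_(k < K) (r / 2 ^+ k) `^ alpha * u k) `^ q <=
    S0 `^ q + C * N `^ (q - p) *
      (\sum_(k < K) (r / 2 ^+ k) `^ (beta * p) * u k `^ p).

Local Notation lam := (2 `^ (- (beta * p))).
Local Notation N' := (2 ^+ (m + n) * N).

Definition cell_average_sum sigma K x : R :=
  \sum_(k < K.+1) lam ^+ k * (\prod_j cell_average sigma k j x) `^ p.

Definition maximal_constant : R :=
  \sum_j (2 * (P j / (P j - 1)) * (2 * (P j / (P j - 1)))^-1 `^ (1 - P j)).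

Let N'0 : 0 < N'. Proof. by rewrite mulr_gt0. Qed.

Let bp0 : 0 < beta * p. Proof. exact: mulr_gt0. Qed.

Let lam0 : 0 < lam :> R. Proof. by rewrite powR_gt0. Qed.

Let lam1 : lam < 1 :> R.
Proof.
rewrite powRN invf_lt1 ?powR_gt0//.
have E1 : 1 `^ (beta * p) = 1 :> R by rewrite powR1.
rewrite -[ltLHS]E1; apply: gt0_ltr_powR; rewrite ?nnegrE//.
by rewrite ltr1n.
Qed.

Let lamX (s : R) k : 0 < s -> s `^ (beta * p) * lam ^+ k = (s / 2 ^+ k) `^ (beta * p).
Proof.
move=> s0; rewrite (powRM _ (ltW s0)) ?invr_ge0 ?(ltW (p2 k))//; congr (_ * _).
rewrite -(powR_mulrn k (powR_ge0 2 _)) -powRrM.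
by rewrite -(powR_invn k (ler0n R 2)) -powRrM; congr (_ `^ _); ring.
Qed.

Let prod_avg0 sigma k x : 0 <= \prod_j cell_average sigma k j x.
Proof. by apply: prodr_ge0 => j _; exact: cell_average_ge0. Qed.

Let cell_average_sum_ge0 sigma K x : 0 <= cell_average_sum sigma K x.
Proof.
apply: sumr_ge0 => k _; apply: mulr_ge0 (powR_ge0 _ _).
by apply: exprn_ge0; exact: powR_ge0.
Qed.

Let measurable_cell_average_sum sigma K :
  measurable_fun setT (cell_average_sum sigma K).
Proof.
apply: measurable_sum => k; apply: measurable_funM => //.
apply: (measurableT_comp (measurable_powR p)).
by apply: measurable_prod => j _; exact: measurable_cell_average.
Qed.

Lemma dyadic_sum_powR_le K x : dyadic_sum K x `^ q <=
  far_sum `^ q + C * N' `^ (q - p) *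
    (\sum_sigma r `^ (beta * p) * cell_average_sum sigma K x).
Proof.
apply: (@le_trans _ _ (far_sum `^ q + C * N' `^ (q - p) *
  (\sum_(k < K.+1) (r / 2 ^+ k) `^ (beta * p) * dyadic_average k x `^ p))).
  apply: (@hedberg r N' (fun k => dyadic_average k x) far_sum K.+1 r0 N'0).
    by move=> k; rewrite dyadic_average_ge0 dyadic_average_le.
  by rewrite far_sum_ge0 /far_sum lexx.
rewrite lerD2l ler_wpM2l//; first by rewrite mulr_ge0 ?powR_ge0 ?(ltW C0).
rewrite -mulr_sumr /cell_average_sum exchange_big/= mulr_sumr.
apply: ler_sum => k _; rewrite -mulr_sumr mulrA lamX//.
apply: ler_wpM2l; first exact: powR_ge0.
(* Here p <= 1 distributes the power over the grids. *)
exact: powR_sum_le_subadd.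
Qed.

(** Since p times the sum of the 1/P_j is 1, the p-th power of the Morrey bound on the tripled cube
    has exponent n - e p. *)
Lemma prod_majorant_le : exists2 G : 'I_m -> R, (forall j, 0 < G j) &
  (forall j, \int[leb]_y (near_part j y `^ P j)%:E <= (G j)%:E)%E /\
  \prod_j G j `^ (p / P j) <= N `^ p * (3 * l) `^ (n%:R - e * p).
Proof.
have l3 : 0 < 3 * l by rewrite mulr_gt0.
have [G [G0 gG GN]] := gP (euclid_shift a (- l)) l3.
exists G; [exact: G0|split => [j|]].
  apply: le_trans (gG j).
  rewrite -(integral_indicM leb (fun y => g j y `^ P j) (measurable_cube _ _)).
  apply: ge0_le_integral_lower => y _; rewrite lee_fin; first exact: powR_ge0.
  rewrite /near_part indicE; case: (_ \in _); first by rewrite !mulr1.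
  by rewrite !mulr0 powR0// gt_eqF//; have := P1 j; lra.
have -> : \prod_j G j `^ (p / P j) = (\prod_j G j `^ (P j)^-1) `^ p.
  rewrite powR_prod; last by move=> j; exact: powR_ge0.
  by apply: eq_bigr => j _; rewrite -powRrM mulrC.
have pS : (\sum_j (P j)^-1) * p = 1.
  by rewrite mulrC mulr_sumr.
have -> : n%:R - e * p = (n%:R * (\sum_j (P j)^-1) - e) * p.
  by rewrite mulrBl -mulrA pS mulr1.
rewrite powRrM -powRM ?powR_ge0 ?(ltW N0)//.
apply: ge0_ler_powR; rewrite ?nnegrE ?(ltW p0)//.
  by apply: prodr_ge0 => j _; exact: powR_ge0.
by rewrite mulr_ge0 ?powR_ge0 ?(ltW N0).
Qed.

Lemma integral_cell_average_sum_le sigma K :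
  (\int[mu]_x (cell_average_sum sigma K x)%:E <=
   (A * l `^ (- (beta * p)) / (1 - lam) *
     (N `^ p * (3 * l) `^ (n%:R - e * p)) * maximal_constant)%:E)%E.
Proof.
have [G G0 [fG GN]] := prod_majorant_le.
have Al0 : 0 <= A * l `^ (- (beta * p)) by rewrite mulr_ge0 ?powR_ge0.
have nest k x y : shifted_grid sigma k.+1 x = shifted_grid sigma k.+1 y ->
    shifted_grid sigma k x = shifted_grid sigma k y by exact: grid_nested.
(* Up to the factor l^(-beta p), lam^k is (l/2^k)^(beta p); multiplied by (l/2^k)^(n - beta p) it
   gives the Lebesgue measure of the cell. *)
have cmp k x : ((lam ^+ k)%:E *
      mu (shifted_grid sigma k @^-1` [set shifted_grid sigma k x]) <=
    (A * l `^ (- (beta * p)))%:E *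
      leb (shifted_grid sigma k @^-1` [set shifted_grid sigma k x]))%E.
  rewrite leb_shifted_grid.
  set Q := shifted_grid sigma k @^-1` _.
  have [b Qb] : exists b, Q `<=` cube b (l / 2 ^+ k) by exact: grid_cell_sub_cube.
  have muQ : (mu Q <= (A * (l / 2 ^+ k) `^ (n%:R - beta * p))%:E)%E.
    apply: le_trans (muA b (lk0 k)); apply: le_measure => //; rewrite inE.
      exact: measurable_shifted_grid.
    exact: measurable_cube.
  have lk : (0 <= (lam ^+ k)%:E)%E by rewrite lee_fin exprn_ge0 ?powR_ge0.
  apply: (le_trans (lee_wpmul2l lk muQ)); rewrite -!EFinM lee_fin.
  rewrite mulrCA -[leRHS]mulrA ler_wpM2l//.
  have -> : lam ^+ k = l `^ (- (beta * p)) * (l / 2 ^+ k) `^ (beta * p).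
    by rewrite -lamX// mulrA -powRD ?(gt_eqF l0) ?implybT// addNr powRr0 mul1r.
  rewrite -mulrA ler_wpM2l ?powR_ge0// -powRD; last by rewrite (gt_eqF (lk0 k)) implybT.
  by rewrite addrC subrK (powR_mulrn _ (ltW (lk0 k))).
apply: (le_trans (trace_inequality (@measurable_shifted_grid sigma) nest
  cell_volume_gt0 (leb_shifted_grid sigma) K lam0 lam1 Al0 cmp p0 P1 pP
  measurable_near_part near_part_ge0 near_part_integrable G0 fG)).
rewrite lee_fin; apply: ler_wpM2r.
  apply: sumr_ge0 => j _; have := P1 j => Pj.
  by rewrite !mulr_ge0 ?powR_ge0 ?invr_ge0//; lra.
apply: ler_wpM2l GN; rewrite divr_ge0//.
by rewrite subr_ge0 ltW.
Qed.

(** The first summand is the far part, the second the near part. The powers of 6 come from r = l/6,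
    that of 3 from the tripled cube, and 2^n counts the grids. *)
Definition trace_constant : R :=
  (far_constant * 2 ^+ (m + n)) `^ q * 6 `^ (p * (e - beta)) +
  C * (2 ^+ (m + n)) `^ (q - p) * (2 ^+ n * (6 `^ (- (beta * p)) / (1 - lam) *
    3 `^ (n%:R - e * p) * maximal_constant)).

Lemma integral_dyadic_sum_le K :
  (\int[mu]_(x in cube a l) (dyadic_sum K x `^ q)%:E <=
   (trace_constant * (A * N `^ q * l `^ (n%:R - e * p)))%:E)%E.
Proof.
have mQ : measurable (cube a l) by exact: measurable_cube.
set B := A * l `^ (- (beta * p)) / (1 - lam) *
     (N `^ p * (3 * l) `^ (n%:R - e * p)) * maximal_constant.
have S0 : 0 <= far_sum `^ q by rewrite powR_ge0.
have CN0 : 0 <= C * N' `^ (q - p) by rewrite mulr_ge0 ?powR_ge0 ?(ltW C0).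
have rb0 : 0 <= r `^ (beta * p) by rewrite powR_ge0.
have mc sigma : measurable_fun (cube a l) (fun x => (cell_average_sum sigma K x)%:E).
  by apply/measurable_EFinP; apply: measurable_funTS; exact: measurable_cell_average_sum.
have c0 sigma x : (0 <= (cell_average_sum sigma K x)%:E)%E.
  by rewrite lee_fin cell_average_sum_ge0.
have intB sigma : (\int[mu]_(x in cube a l) (cell_average_sum sigma K x)%:E <= B%:E)%E.
  apply: le_trans (integral_cell_average_sum_le sigma K).
  apply: ge0_subset_integral => //.
  by apply/measurable_EFinP; exact: measurable_cell_average_sum.
apply: (@le_trans _ _ (\int[mu]_(x in cube a l) ((far_sum `^ q)%:E +
  (C * N' `^ (q - p))%:E *
    (\sum_sigma (r `^ (beta * p))%:E * (cell_average_sum sigma K x)%:E)))%E).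
  apply: ge0_le_integral_lower => x _; first by rewrite lee_fin powR_ge0.
  rewrite (eq_bigr (fun sigma => (r `^ (beta * p) * cell_average_sum sigma K x)%:E))//.
  by rewrite sumEFin -EFinM -EFinD lee_fin dyadic_sum_powR_le.
have ms : measurable_fun (cube a l) (fun x => \sum_sigma (r `^ (beta * p))%:E *
    (cell_average_sum sigma K x)%:E)%E.
  by apply: emeasurable_sum => s; exact: measurable_funeM.
have s0 x : (0 <= \sum_sigma (r `^ (beta * p))%:E *
    (cell_average_sum sigma K x)%:E)%E.
  by apply: sume_ge0 => s _; rewrite mule_ge0.
rewrite (ge0_integralD mu mQ (f1 := cst (far_sum `^ q)%:E)); last 4 first.
- by move=> x _; rewrite lee_fin.
- exact: measurable_cst.
- by move=> x _; rewrite mule_ge0.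
- exact: measurable_funeM.
rewrite integral_cst// (ge0_integralZl_EFin mu mQ (fun x _ => s0 x) ms CN0).
rewrite ge0_integral_sum//; last 2 first.
- by move=> s; exact: measurable_funeM.
- by move=> s x _; rewrite mule_ge0.
apply: (@le_trans _ _ (far_sum `^ q * (A * l `^ (n%:R - beta * p)) +
  C * N' `^ (q - p) * \sum_(sigma : {ffun 'I_n -> bool}) r `^ (beta * p) * B)%:E).
  rewrite EFinD !EFinM; apply: leeD.
    by rewrite lee_wpmul2l// -EFinM muA.
  rewrite lee_wpmul2l// -sumEFin; apply: lee_sum => s _.
  rewrite (ge0_integralZl_EFin mu mQ (fun x _ => c0 s x) (mc s) rb0).
  by rewrite EFinM lee_wpmul2l.
rewrite lee_fin sumr_const card_ffun card_bool card_ord -(mulr_natl (r `^ (beta * p) * B)) natrX.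
have lE y z : l `^ (y + z) = l `^ y * l `^ z by rewrite powRD// (gt_eqF l0) implybT.
have NE y z : N `^ (y + z) = N `^ y * N `^ z by rewrite powRD// (gt_eqF N0) implybT.
have q0 : q = (q - p) + p by rewrite subrK.
have far_eq : far_sum `^ q * l `^ (n%:R - beta * p) =
    (far_constant * 2 ^+ (m + n)) `^ q * 6 `^ (p * (e - beta)) *
      (N `^ q * l `^ (n%:R - e * p)).
  have -> : far_sum = far_constant * 2 ^+ (m + n) * (N * r `^ (alpha - e)).
    by rewrite /far_sum; ring.
  have Nr0 : 0 <= N * r `^ (alpha - e) by rewrite mulr_ge0 ?powR_ge0 ?(ltW N0).
  have fc0 : 0 <= far_constant * 2 ^+ (m + n).
    by rewrite mulr_ge0 ?far_constant_ge0// (ltW (p2 _)).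
  rewrite (powRM _ fc0 Nr0) (powRM _ (ltW N0) (powR_ge0 _ _)) -powRrM.
  have -> : (alpha - e) * q = - (p * (e - beta)) by rewrite -qp; ring.
  have -> : n%:R - e * p = - (p * (e - beta)) + (n%:R - beta * p) by ring.
  rewrite (lE (- (p * (e - beta)))) (powRM _ (ltW l0)) ?invr_ge0//.
  have -> : 6^-1 `^ (- (p * (e - beta))) = 6 `^ (p * (e - beta)) :> R.
    by rewrite -(powR_inv1 (ler0n R 6)) -powRrM mulrNN mul1r.
  by ring.
have B_eq : r `^ (beta * p) * B = 6 `^ (- (beta * p)) / (1 - lam) *
    3 `^ (n%:R - e * p) * maximal_constant * (A * N `^ p * l `^ (n%:R - e * p)).
  rewrite /B (powRM _ (ltW l0)) ?invr_ge0//.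
  have -> : 6^-1 `^ (beta * p) = 6 `^ (- (beta * p)) :> R.
    by rewrite -(powR_inv1 (ler0n R 6)) -powRrM mulN1r.
  rewrite (powRM _ (ler0n R 3) (ltW l0)).
  have ll : l `^ (beta * p) * l `^ (- (beta * p)) = 1 by rewrite -lE subrr powRr0.
  rewrite -[RHS]mul1r -ll; ring.
have N'E : N' `^ (q - p) = (2 ^+ (m + n)) `^ (q - p) * N `^ (q - p).
  by rewrite (powRM _ (ltW (p2 _)) (ltW N0)).
have NqE : N `^ q = N `^ (q - p) * N `^ p by rewrite {1}q0 NE.
rewrite mulrCA far_eq B_eq N'E /trace_constant NqE.
rewrite le_eqVlt; apply/orP; left; apply/eqP; ring.
Qed.

(** [I] is first compared with the measurable limit; monotone convergence then applies, with bounds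
    uniform in [K]. *)
Lemma local_trace (c : R) (I : E -> \bar R) : 0 <= c -> (forall x, 0 <= I x)%E ->
  (forall x, cube a l x -> I x <= c%:E *
     limn (fun K => (dyadic_sum K x `^ q)%:E))%E ->
  (\int[mu]_(x in cube a l) I x <=
   (c * trace_constant * (A * N `^ q * l `^ (n%:R - e * p)))%:E)%E.
Proof.
move=> k0 I0 Ile; have mQ : measurable (cube a l) by exact: measurable_cube.
have q0 : 0 <= q by rewrite (le_trans (ltW p0)).
have mT K : measurable_fun (cube a l) (fun x => (dyadic_sum K x `^ q)%:E).
  apply/measurable_EFinP; apply: measurable_funTS.
  by apply: (measurableT_comp (measurable_powR q)); exact: measurable_dyadic_sum.
have T0 K x : (0 <= (dyadic_sum K x `^ q)%:E)%E by rewrite lee_fin powR_ge0.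
have ndT x : {homo (fun K => (dyadic_sum K x `^ q)%:E) :
    K K' / (K <= K')%N >-> (K <= K')%E}.
  move=> K K' KK'; rewrite lee_fin.
  by apply: ge0_ler_powR; rewrite ?nnegrE ?dyadic_sum_ge0// dyadic_sum_ndecr.
have cvgT x : cvgn (fun K => (dyadic_sum K x `^ q)%:E) by exact: ereal_nondecreasing_is_cvgn.
have lim0 x : (0 <= limn (fun K => (dyadic_sum K x `^ q)%:E))%E.
  by apply: lime_ge => //; apply: nearW.
apply: (le_trans (ge0_le_integral_lower mu (fun x _ => I0 x) Ile)).
have mlim : measurable_fun (cube a l) (fun x => limn (fun K => (dyadic_sum K x `^ q)%:E)).
  by apply: (emeasurable_fun_cvg (fun K x => (dyadic_sum K x `^ q)%:E)) => // x _; exact: cvgT.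
rewrite (ge0_integralZl_EFin mu mQ (fun x _ => lim0 x) mlim k0).
rewrite -mulrA EFinM lee_wpmul2l//.
rewrite (monotone_convergence mu mQ mT (fun K x _ => T0 K x) (fun x _ => ndT x)).
apply: lime_le.
  apply: ereal_nondecreasing_is_cvgn => K K' KK'.
  by apply: ge0_le_integral_lower => x _ //; exact: ndT.
by apply: nearW => K; exact: integral_dyadic_sum_le.
Qed.

End trace.

End local_estimate.

(** * Reduction to Borel functions *)

Lemma negligible_countable_bigcup d (T : measurableType d) (R : realType)
    (mu : {measure set T -> \bar R}) (I : countType) (F : I -> set T) :
  (forall i, mu.-negligible (F i)) -> mu.-negligible (\bigcup_i F i).
Proof.
move=> nF; pose G k := if @unpickle I k is Some i then F i else set0.
have FG : \bigcup_i F i `<=` \bigcup_k G k.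
  by move=> x [i _ Fx]; exists (pickle i) => //; rewrite /G pickleK.
apply: negligibleS FG _; apply: negligible_bigcup => k; rewrite /G.
by case: unpickle => [i|]; [exact: nF|exact: negligible_set0].
Qed.

Section borel_reduction.
Context {R : realType} {n : nat}.
Local Notation E := (euclid R n).
Local Notation leb := (@leb R n).

(** For rational q the set |f| > q is Borel up to a null set; [h] is |f| set to 0 on the union of
    these null sets. Lying below |f| everywhere, [h] inherits the Morrey bound. *)
Lemma lebesgue_measurable_borel (f : E -> R) : lebesgue_measurable_fun f ->
  exists h Z, [/\ measurable_fun setT (h : E -> R), measurable Z, leb Z = 0%E,
    forall x, 0 <= h x <= `|f x| & forall x, ~ Z x -> h x = `|f x|].
Proof.
move=> mf; pose B (q : rat) : set (measurableTypeR R) := [set t | ratr q < `|t : R|].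
have mB q : measurable (B q).
  rewrite (_ : B q = (fun t : measurableTypeR R => `|t : R|) @^-1` `]ratr q, +oo[).
    rewrite -[X in measurable X]setTI.
    by apply: (normr_measurable measurableT); exact: measurable_itv.
  by apply/seteqP; split => t /=; rewrite in_itv/= andbT.
have /choice[AZ AZE] q : exists AZ : set E * set E, [/\ measurable AZ.1,
    measurable AZ.2, leb AZ.2 = 0%E, AZ.1 `<=` f @^-1` B q &
    f @^-1` B q `<=` AZ.1 `|` AZ.2].
  have [A mA [N [Z [mZ Z0 NZ]] ANE]] := mf _ (mB q).
  exists (A, Z); split => //=; first by rewrite -ANE => x; left.
  by rewrite -ANE => x [|/NZ]; [left|right].
have ratcount : countable [set: rat] by exact: countableP.
pose Z := \bigcup_q (AZ q).2.
have mZ : measurable Z.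
  by apply: countable_bigcupT_measurable => // q; have [] := AZE q.
have Z0 : leb Z = 0%E.
  apply/negligibleP => //.
  apply: negligible_countable_bigcup => q.
  by exists (AZ q).2; have [] := AZE q; split.
pose h (x : E) : R := if x \in Z then 0 else `|f x|.
exists h, Z; split => //; last first.
- by move=> x nZx; rewrite /h ifF//; apply/negbTE; rewrite notin_setE.
- by move=> x; rewrite /h; case: ifP => _; rewrite ?lexx normr_ge0.
move=> _; apply: (measurability _ (RGenOInfty.measurableE R)) => //.
move=> /= _ [_ [s ->] <-]; rewrite setTI.
have [s0|s0] := ltP s 0.
  rewrite (_ : _ @^-1` _ = setT)//; apply/seteqP; split => // x _ /=.
  rewrite in_itv/= andbT; apply: lt_le_trans s0 _.
  by rewrite /h; case: ifP.
(* As s >= 0, h > s forces x outside [Z], where the Borel parts at rational levels q >= s describe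
   |f| > s. *)
rewrite (_ : _ @^-1` _ =
  \bigcup_(q : rat) if s <= ratr q then (AZ q).1 `\` Z else set0).
  apply: countable_bigcupT_measurable => // q; case: ifP => _.
    by apply: measurableD => //; have [] := AZE q.
  exact: measurable0.
apply/seteqP; split => x /=.
  rewrite in_itv/= andbT /h; case: ifPn => [_|xZ]; first by rewrite ltNge s0.
  move=> sf; have [q] := rat_in_itvoo sf.
  rewrite in_itv/= => /andP[sq qf]; exists q => //; rewrite (ltW sq); split.
    have [_ _ _ _ /(_ x qf)[//|Zx]] := AZE q.
    by move: xZ; rewrite notin_setE => /(_ _)[]; exists q.
  by move: xZ; rewrite notin_setE.
case=> q _; case: ifPn => // sq [Ax nZx].
rewrite in_itv/= andbT /h ifF; last by apply/negbTE; rewrite notin_setE.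
have [_ _ _ /(_ x Ax) qf _] := AZE q.
exact: le_lt_trans sq qf.
Qed.

Lemma negligible_coordinates (m : nat) (Z : 'I_m -> set E) :
  (forall j, measurable (Z j)) -> (forall j, leb (Z j) = 0%E) ->
  exists W : set (m.-tuple E), [/\ measurable W, tuple_measure leb m W = 0%E &
    forall y, ~ W y -> forall j, ~ Z j (tnth y j)].
Proof.
move=> mZ Z0.
have nj j : (tuple_measure leb m).-negligible [set y | Z j (tnth y j)].
  exists [set y | Z j (tnth y j)]; split => //.
    rewrite -[X in measurable X]setTI.
    exact: (measurable_tnth j measurableT (mZ j)).
  pose A i := if i == j then Z j else setT.
  rewrite (_ : mkset _ = [set y | forall i, A i (tnth y i)]).
    rewrite tuple_measure_box; last by move=> i; rewrite /A; case: ifP.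
    by rewrite (bigD1 j)//= /A eqxx Z0 mul0e.
  apply/seteqP; split => y /=; last by move=> /(_ j); rewrite /A eqxx.
  by move=> Zy i; rewrite /A; case: eqP => [->|].
have : (tuple_measure leb m).-negligible
    (\big[setU/set0]_(j < m) [set y | Z j (tnth y j)]).
  elim/big_ind : _ => //; [exact: negligible_set0|exact: negligibleU].
case=> W [mW W0 sW]; exists W; split => // y nWy j Zy; apply: nWy; apply: sW.
by rewrite -bigcup_seq; exists j => //=; rewrite mem_index_enum.
Qed.

Lemma fractional_integral_eq0 (m : nat) (alpha : R) (f : 'I_m -> E -> R) j Z x :
  measurable Z -> leb Z = 0%E -> (forall y, ~ Z y -> f j y = 0) ->
  fractional_integral alpha f x = 0%E.
Proof.
move=> mZ Z0 fZ.
have [W [mW W0 WZ]] := @negligible_coordinates m (fun=> Z) (fun=> mZ) (fun=> Z0).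
rewrite /fractional_integral; set F := fun y => _%:E.
have : (`|\int[tuple_measure leb m]_y F y| <= 0)%E.
  apply: (le_trans (abse_integral_le_lower _ _)).
  have := @ge0_le_integral_lower_ae _ _ _ (tuple_measure leb m) W
    (fun y => `|F y|)%E (cst 0%E) mW W0 (@measurable_cst _ _ _ _ _ _)
    (fun y => abse_ge0 _) (fun y => lexx _).
  rewrite integral0 => H.
  rewrite -[leRHS](mule0 2%:E) lee_wpmul2l// H// => y /WZ/(_ j)/fZ fy.
  by rewrite /F (bigD1 j)//= fy !mul0r normr0.
by move=> le0; apply/eqP; rewrite -abse_eq0 eq_le le0 abse_ge0.
Qed.

Lemma measurable_powR_EFin (h : E -> R) (s : R) : measurable_fun setT h ->
  measurable_fun setT (fun y => (h y `^ s)%:E).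
Proof.
by move=> mh; apply/measurable_EFinP; exact: measurableT_comp (measurable_powR s) mh.
Qed.

Lemma integral_powR_eq0 (h : E -> R) (s : R) : measurable_fun setT h ->
  (forall y, 0 <= h y) -> 0 < s -> (\int[leb]_y (h y `^ s)%:E = 0)%E ->
  exists Z, [/\ measurable Z, leb Z = 0%E & forall y, ~ Z y -> h y = 0].
Proof.
move=> mh h0 s0 i0.
have := ae_eq_integral_abs leb measurableT (measurable_powR_EFin s mh).
case=> + _ => /(_ _)[|Z [mZ Z0 sZ]].
  rewrite -[RHS]i0; apply: eq_integral => y _.
  by rewrite gee0_abs// lee_fin powR_ge0.
exists Z; split => // y nZy; apply: contrapT => hy.
apply: nZy; apply: sZ => /= /(_ I)/eqP.
rewrite eqe powR_eq0 => /andP[/eqP + _]; exact: hy.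
Qed.

End borel_reduction.

(** * Exhaustion of the space by centered cubes *)

Section centered_cubes.
Context {R : realType} {n : nat}.
Local Notation E := (euclid R n).
Local Notation leb := (@leb R n).

Definition centered_cube (k : nat) : set E :=
  cube [tuple - (k.+1%:R : R) | i < n] (2 * k.+1%:R).

Lemma centered_cube_ndecr : nondecreasing_seq centered_cube.
Proof.
move=> k k' kk'; rewrite subsetEset => x Hx i.
have := Hx i; rewrite !tnth_mktuple.
have : (k.+1%:R : R) <= k'.+1%:R by rewrite ler_nat.
by move=> ? /andP[? ?]; apply/andP; split; lra.
Qed.

Lemma cube_sub_centered_cube (a : E) (l : R) : exists k, cube a l `<=` centered_cube k.
Proof.
pose M := \sum_i `|tnth a i : R| + `|l|.
have Mi i : `|tnth a i : R| + `|l| <= M.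
  by rewrite lerD2r (bigD1 i)//= lerDl sumr_ge0.
exists (Num.truncn M) => x Hx i; have := Hx i; rewrite tnth_mktuple.
have := truncnS_gt M; have := Mi i.
have := ler_norm (tnth a i : R); have := ler_norm (- tnth a i : R).
have := ler_norm l; rewrite normrN.
move: (`|_|) (`|l|) ((Num.truncn M).+1%:R) => u v w ? ? ? ? ? /andP[? ?].
by apply/andP; split; lra.
Qed.

Lemma exists_integral_centered_cube_gt0 (h : E -> \bar R) : measurable_fun setT h ->
  (forall y, 0 <= h y)%E -> (\int[leb]_y h y != 0)%E ->
  exists k, forall k', (k <= k')%N -> (0 < \int[leb]_(y in centered_cube k') h y)%E.
Proof.
move=> mh h0 ih.
have mC k : measurable (centered_cube k) by exact: measurable_cube.
have ge0 k : (0 <= \int[leb]_(y in centered_cube k) h y)%E by exact: integral_ge0.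
have [[k hk]|none] := pselect (exists k, (\int[leb]_(y in centered_cube k) h y != 0)%E).
  exists k => k' kk'; have : (0 < \int[leb]_(y in centered_cube k) h y)%E.
    by rewrite lt_neqAle eq_sym hk ge0.
  move=> /lt_le_trans; apply; apply: ge0_subset_integral => //.
    exact: measurable_funTS.
  by rewrite -subsetEset; exact: centered_cube_ndecr.
exfalso; move/negP: ih; apply; apply/eqP.
have cup : \bigcup_k centered_cube k = setT.
  apply/seteqP; split => // x _.
  have [k Hk] := cube_sub_centered_cube x 0.
  by exists k => //; apply: Hk => i; rewrite addr0 lexx.
have := @ge0_nondecreasing_set_cvg_integral _ _ R centered_cube h leb
  centered_cube_ndecr mC (fun i => measurable_funTS mh) (fun i x _ => h0 x).
rewrite cup => /cvg_lim <-//.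
rewrite (_ : (fun i => _) = cst 0%E) ?lim_cst//; apply/funext => k.
by apply/eqP; apply: contrapT => /negP hk; apply: none; exists k.
Qed.

End centered_cubes.

(** * Morrey norms *)

Lemma prode_gt0 (R : realType) (I : Type) (s : seq I) (Q : pred I) (x : I -> \bar R) :
  (forall i, 0 < x i)%E -> (0 < \prod_(i <- s | Q i) x i)%E.
Proof.
by move=> x0; elim/big_ind : _ => // y z; exact: mule_gt0.
Qed.

(** With 0 times +oo equal to 0, a finite norm does not by itself exclude an infinite factor next to
    a vanishing one. As no [h j] vanishes almost everywhere, all factors are positive on large
    centered cubes, and an infinite one there would make the norm infinite. *)
Lemma product_morrey_bound (R : realType) (m n : nat) (P : 'I_m -> R) (p0 : R)
    (f h : 'I_m -> euclid R n -> R) :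
  (0 < n)%N -> (forall j, 1 < P j) ->
  (forall j, measurable_fun setT (h j)) ->
  (forall j x, 0 <= h j x <= `|f j x|) ->
  (forall j, \int[@leb R n]_y (h j y `^ P j)%:E != 0)%E ->
  (product_morrey_norm P p0 f < +oo)%E ->
  exists N : R, [/\ 0 < N, product_morrey_norm P p0 f = N%:E &
    forall (a : euclid R n) (l : R), 0 < l -> exists G : 'I_m -> R,
    [/\ forall j, 0 < G j,
        forall j, (\int[@leb R n]_(y in cube a l) (h j y `^ P j)%:E <= (G j)%:E)%E &
        \prod_j G j `^ (P j)^-1 <= N * l `^ (n%:R * (\sum_j (P j)^-1) - n%:R / p0)]].
Proof.
move=> n0 P1 mh hf hn0 Noo.
pose F j Q := (\int[@leb R n]_(y in Q) (h j y `^ P j)%:E)%E.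
have mhP j : measurable_fun setT (fun y => (h j y `^ P j)%:E).
  exact: measurable_powR_EFin.
have F0 j Q : (0 <= F j Q)%E.
  by apply: integral_ge0 => y _; rewrite lee_fin powR_ge0.
have Pi0 j : 0 < (P j)^-1 by rewrite invr_gt0; have := P1 j; lra.
have h0 j x : 0 <= h j x by case/andP: (hf j x).
have term (a : euclid R n) l : 0 < l -> (((l ^+ n) `^ p0^-1)%:E *
    \prod_j (((l ^+ n)^-1)%:E * F j (cube a l)) `^ (P j)^-1 <=
    product_morrey_norm P p0 f)%E.
  move=> l0; have V0 : 0 < l ^+ n by rewrite exprn_gt0.
  apply: (@le_trans _ _ (((vol (cube a l)) `^ p0^-1)%:E * \prod_(j < m)
      ((vol (cube a l))^-1%:E *
       \int[@leb R n]_(y in cube a l) (`|f j y| `^ P j)%:E) `^ (P j)^-1)%E); last first.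
    by apply: ereal_sup_ubound; exists (cube a l) => //; exists a, l.
  rewrite (vol_cube a l0); apply: lee_wpmul2l; first by rewrite lee_fin powR_ge0.
  apply: lee_prod_ge0 => j; first exact: poweR_ge0.
  have Vi : (0 <= (l ^+ n)^-1%:E)%E by rewrite lee_fin invr_ge0 ltW.
  apply: ge0_le_poweR; [exact: ltW|exact: mule_ge0|].
  apply: (lee_wpmul2l Vi); apply: ge0_le_integral_lower => y _.
    by rewrite lee_fin powR_ge0.
  rewrite lee_fin; case/andP: (hf j y) => ? ?; apply: ge0_ler_powR; rewrite ?nnegrE//.
  by have := P1 j; lra.
have sub_le j (Q Q' : set (euclid R n)) : measurable Q -> measurable Q' ->
    Q `<=` Q' -> (F j Q <= F j Q')%E.
  move=> mQ mQ' QQ'; apply: ge0_subset_integral => //.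
    exact: measurable_funTS.
  by move=> y _; rewrite lee_fin powR_ge0.
have [k kF] : exists k, forall k', (k <= k')%N -> forall j, (0 < F j (centered_cube k'))%E.
  have /fin_all_exists[k kE] j := exists_integral_centered_cube_gt0 (mhP j)
    (fun y => powR_ge0 _ _ : (0 <= (h j y `^ P j)%:E)%E) (hn0 j).
  exists (\max_j k j) => k' kk' j; apply: kE; apply: leq_trans kk'.
  exact: leq_bigmax.
have C0 k' : 0 < 2 * k'.+1%:R :> R by rewrite mulr_gt0// ltr0n.
have Vpos k' : (0 < ((2 * k'.+1%:R) ^+ n)^-1%:E :> \bar R)%E.
  by rewrite lte_fin invr_gt0 exprn_gt0.
have tpos k' j : (k <= k')%N ->
    (0 < (((2 * k'.+1%:R) ^+ n)^-1%:E * F j (centered_cube k')) `^ (P j)^-1)%E.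
  by move=> /kF kk'; apply: poweR_gt0; exact: mule_gt0.
have vpos k' : (0 < (((2 * k'.+1%:R) ^+ n) `^ p0^-1)%:E :> \bar R)%E.
  by rewrite lte_fin powR_gt0// exprn_gt0.
have Ffin (a : euclid R n) l j : 0 < l -> (F j (cube a l) < +oo)%E.
  move=> l0; have [k0 k0E] := cube_sub_centered_cube a l.
  pose k' := maxn k k0; have kk' : (k <= k')%N by exact: leq_maxl.
  apply: (@le_lt_trans _ _ (F j (centered_cube k'))).
    apply: sub_le; [exact: measurable_cube|exact: measurable_cube|].
    apply: (subset_trans k0E); rewrite -subsetEset.
    by apply: centered_cube_ndecr; exact: leq_maxr.
  rewrite ltNge leye_eq; apply/negP => /eqP Foo.
  have := term _ _ (C0 k') => /(_ [tuple - (k'.+1%:R : R) | i < n]).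
  rewrite (bigD1 j)//= -/(centered_cube k') Foo gt0_muley// poweRyr ?gt_eqF//.
  rewrite gt0_mulye; last by apply: prode_gt0 => i; exact: tpos.
  by rewrite gt0_muley// leye_eq => /eqP E; move: Noo; rewrite E ltxx.
have Npos : (0 < product_morrey_norm P p0 f)%E.
  apply: lt_le_trans (term _ _ (C0 k)); apply: mule_gt0 => //.
  by apply: prode_gt0 => j; exact: tpos.
move: Npos Noo term; case: (product_morrey_norm P p0 f) => [N||]// N0 _ term.
exists N; split => // a l l0; have V0 : 0 < l ^+ n by rewrite exprn_gt0.
pose Fr j := fine (F j (cube a l)).
have FrE j : F j (cube a l) = (Fr j)%:E.
  by rewrite fineK// ge0_fin_numE// Ffin.
have Fr0 j : 0 <= Fr j by rewrite fine_ge0.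
have : \prod_j Fr j `^ (P j)^-1 <= N * l `^ (n%:R * (\sum_j (P j)^-1) - n%:R / p0).
  have := term a l l0.
  rewrite (eq_bigr (fun j => (((l ^+ n)^-1 * Fr j) `^ (P j)^-1)%:E)); last first.
    by move=> j _; rewrite FrE -EFinM poweR_EFin.
  rewrite prodEFin -EFinM lee_fin.
  have -> : \prod_j ((l ^+ n)^-1 * Fr j) `^ (P j)^-1 =
      l `^ (- (n%:R * \sum_j (P j)^-1)) * \prod_j Fr j `^ (P j)^-1.
    rewrite -mulrN -sumrN mulr_sumr.
    have -> : l `^ (\sum_j n%:R * - (P j)^-1) = \prod_j l `^ (n%:R * - (P j)^-1).
      elim/big_rec2 : _ => [|j x y _ <-]; first by rewrite powRr0.
      by rewrite powRD// (gt_eqF l0) implybT.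
    rewrite -big_split/=; apply: eq_bigr => j _.
    rewrite powRM ?invr_ge0 ?(ltW V0)//; congr (_ * _).
    rewrite -(powR_invn n (ltW l0)) -powRrM; congr (_ `^ _); ring.
  rewrite -(powR_mulrn n (ltW l0)) -powRrM mulrA -powRD; last first.
    by rewrite (gt_eqF l0) implybT.
  set t := \sum_j _.
  have -> : n%:R / p0 + - (n%:R * t) = - (n%:R * t - n%:R / p0) by ring.
  by rewrite powRN ler_pdivrMl ?powR_gt0// mulrC.
have N0' : 0 < N by rewrite lte_fin in N0.
move=> /(exists_pos_majorant Pi0 Fr0 _)[|G [G0 FG GN]].
  by rewrite mulr_gt0 ?powR_gt0.
by exists G; split => // j; rewrite -/(F j _) FrE lee_fin.
Qed.

Lemma measure_norm_ge0 (R : realType) (n : nat) (mu : {measure set (euclid R n) -> \bar R})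
    (g : R) : (0 <= measure_norm mu g)%E.
Proof.
pose a : euclid R n := [tuple 0 | i < n].
apply: (@le_trans _ _ (mu (cube a 1) * ((side (cube a 1) `^ g)^-1)%:E)%E).
  by rewrite mule_ge0// lee_fin invr_ge0 powR_ge0.
by apply: ereal_sup_ubound; exists (cube a 1) => //; exists a, 1.
Qed.

Lemma measure_norm_cube (R : realType) (n : nat)
    (mu : {measure set (euclid R n) -> \bar R}) (g A s : R) (b : euclid R n) :
  (0 < n)%N -> measure_norm mu g = A%:E -> 0 < s ->
  (mu (cube b s) <= (A * s `^ g)%:E)%E.
Proof.
move=> n0 muA s0; have : (mu (cube b s) * ((s `^ g)^-1)%:E <= A%:E)%E.
  rewrite -muA -{2}(side_cube b n0 s0).
  by apply: ereal_sup_ubound; exists (cube b s) => //; exists b, s.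
by rewrite EFinM muleC lee_pdivrMl ?powR_gt0// muleC.
Qed.

Lemma product_morrey_norm_ge0 (R : realType) (m n : nat) (P : 'I_m -> R) (p0 : R)
    (f : 'I_m -> euclid R n -> R) : (0 <= product_morrey_norm P p0 f)%E.
Proof.
pose a : euclid R n := [tuple 0 | i < n].
apply: le_trans (ereal_sup_ubound _); last by exists (cube a 1) => //; exists a, 1.
rewrite mule_ge0 ?lee_fin ?powR_ge0//.
by apply: prode_ge0 => j _; exact: poweR_ge0.
Qed.

(** * Choice of the constants, degenerate cases and conclusion *)

Theorem theorem1p2 (R : realType) (m n : nat) (P : 'I_m -> R)
    (p p0 alpha beta theta q q0 : R) :
  (0 < m)%N -> (0 < n)%N ->
  (forall j, 1 < P j) ->
  p^-1 = \sum_(j < m) (P j)^-1 ->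
  0 < p -> p <= p0 -> p0 < n%:R / alpha -> p <= 1 ->
  0 < beta -> beta <= alpha -> alpha < m%:R * n%:R ->
  theta = (n%:R - beta * p0) / (n%:R - alpha * p0) ->
  q = theta * p -> q0 = theta * p0 ->
  exists C : R, 0 < C /\
    forall (mu : {measure set (euclid R n) -> \bar R})
           (f : 'I_m -> euclid R n -> R),
      radon_measure mu -> product_morrey P p0 f ->
      (radon_morrey_norm mu q q0 (fractional_integral alpha f) <=
       C%:E * measure_norm mu (n%:R - beta * p) `^ q^-1 *
       product_morrey_norm P p0 f)%E.
Proof.
move=> m0 n0 P1 pP p_gt0 pp0 p0n p1 beta0 ba amn thetaE qE q0E.
have p0_gt0 : 0 < p0 by rewrite (lt_le_trans p_gt0).
have alpha0 : 0 < alpha by rewrite (lt_le_trans beta0).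
have ap0 : 0 < n%:R - alpha * p0.
  by rewrite subr_gt0 mulrC -ltr_pdivlMr.
have theta1 : 1 <= theta.
  by rewrite thetaE ler_pdivlMr// mul1r lerD2l lerN2 ler_pM2r.
have theta0 : 0 < theta by rewrite (lt_le_trans ltr01).
have q_gt0 : 0 < q by rewrite qE mulr_gt0.
have pq : p <= q by rewrite qE ler_peMl// ltW.
pose e := n%:R / p0.
have ae : alpha < e by rewrite /e ltr_pdivlMr// -subr_gt0.
have e0 : 0 < e by rewrite (lt_trans alpha0).
have qp : q * (e - alpha) = p * (e - beta).
  rewrite qE thetaE /e; field.
  by rewrite (gt_eqF p0_gt0) (gt_eqF ap0).
have PpE : \sum_j p / P j = 1.
  by rewrite -mulr_sumr -pP divff// gt_eqF.
have [C0 C0_gt0 hed] := hedberg_sum p_gt0 p1 pq ae qp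
  (far_constant_ge0 m n ae).
(* The factor 2^q comes from [abse_integral_le_lower]. *)
pose c : R := 2 `^ q * kernel_constant m n alpha `^ q.
have c_ge0 : 0 <= c by rewrite mulr_ge0 ?powR_ge0.
(* The absolute value here and the added 1 in the witness secure the signs. *)
pose T := `|trace_constant n P e alpha p q beta C0|.
exists ((c * T) `^ q^-1 + 1); split; first by rewrite ltr_wpDl ?powR_ge0.
move=> mu f _ [fint fnorm].
have rhs_ge0 : (0 <= ((c * T) `^ q^-1 + 1)%:E *
    measure_norm mu (n%:R - beta * p) `^ q^-1 * product_morrey_norm P p0 f)%E.
  rewrite !mule_ge0 ?poweR_ge0 ?product_morrey_norm_ge0//.
  by rewrite lee_fin addr_ge0 ?powR_ge0.
have /fin_all_exists[h /fin_all_exists[Z hZ]] j :=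
  lebesgue_measurable_borel (fint j).1.
have mh j : measurable_fun setT (h j) by have [] := hZ j.
have mZ j : measurable (Z j) by have [] := hZ j.
have Z0 j : @leb R n (Z j) = 0%E by have [] := hZ j.
have hf j x : 0 <= h j x <= `|f j x| by have [_ _ _ + _] := hZ j.
have hE j x : ~ Z j x -> h j x = `|f j x| by have [_ _ _ _ H] := hZ j; exact: H.
have h0 j x : 0 <= h j x by case/andP: (hf j x).
apply: ge_ereal_sup => _ [_ [a [l [l0 ->]]] <-].
have [[j hj]|hn0] := pselect (exists j, (\int[@leb R n]_y (h j y `^ P j)%:E = 0)%E).
  have Pj0 : 0 < P j by have := P1 j; lra.
  have [Z' [mZ' Z'0 hZ']] := integral_powR_eq0 (mh j) (h0 j) Pj0 hj.
  have I0 x : fractional_integral alpha f x = 0%E.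
    apply: (@fractional_integral_eq0 _ _ _ _ _ j (Z j `|` Z')).
    - exact: measurableU.
    - rewrite measureU0; [exact: Z0|exact: mZ|exact: mZ'|exact: Z'0].
    - move=> y /not_orP[Zy Z'y]; apply/eqP; rewrite -normr_eq0 -hE//.
      by rewrite hZ'.
  rewrite (@integral0_eq _ _ _ mu) ?poweR0r ?mule0 ?invr_eq0 ?gt_eqF//.
  by move=> x _; rewrite I0 abse0 poweR0r// gt_eqF.
have hn0' j : (\int[@leb R n]_y (h j y `^ P j)%:E != 0)%E.
  by apply/eqP => hj; apply: hn0; exists j.
have [N [N0 NE gP]] := product_morrey_bound n0 P1 mh hf hn0' fnorm.
rewrite NE in rhs_ge0 *.
move: (measure_norm_ge0 mu (n%:R - beta * p)) rhs_ge0.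
case EA : (measure_norm mu (n%:R - beta * p)) => [A||]// A0 _; last first.
  (* For infinite norm of [mu] the right-hand side is +oo, since the constant and [N] are
     positive. *)
  rewrite poweRyr ?invr_eq0 ?(gt_eqF q_gt0)// gt0_muley; last first.
    by rewrite lte_fin ltr_wpDl ?powR_ge0.
  by rewrite gt0_mulye ?leey// lte_fin.
rewrite lee_fin in A0.
have muA b s : 0 < s -> (mu (cube b s) <= (A * s `^ (n%:R - beta * p))%:E)%E.
  by move=> s0; exact: measure_norm_cube.
have [W [mW W0 WZ]] := negligible_coordinates mZ Z0.
pose I x := (`|fractional_integral alpha f x| `^ q)%E.
have Ile x : cube a l x -> (I x <= c%:E *
    limn (fun K => (dyadic_sum h N e alpha a l K x `^ q)%:E))%E.
  move=> ax; rewrite /I /fractional_integral; set F := fun y => _%:E.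
  have Fle y : ~ W y -> (`|F y| <= ((\prod_j h j (tnth y j)) /
      (\sum_j euclid_dist x (tnth y j)) `^ (m%:R * n%:R - alpha))%:E)%E.
    move=> /WZ Wy; rewrite /F lee_fin normrM normr_prod.
    rewrite (ger0_norm (_ : 0 <= (_ `^ _)^-1)) ?invr_ge0 ?powR_ge0//.
    by rewrite (eq_bigr (fun j => h j (tnth y j)))// => j _; rewrite hE.
  have := powR_integral_le_lim P1 mh h0 N0 gP ae amn l0 q_gt0 ax mW W0
    (fun y => abse_ge0 (F y)) Fle.
  move=> key; apply: (le_trans (ge0_le_poweR (ltW q_gt0) (abse_ge0 _)
    (abse_integral_le_lower _ _))).
  rewrite poweRM ?lee_fin//; last exact: integral_ge0.
  by rewrite poweR_EFin /c EFinM -muleA lee_wpmul2l ?lee_fin ?powR_ge0.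
have := local_trace P1 mh h0 N0 gP ae e0 l0 A0 muA p_gt0 p1 pq beta0 qp PpE
  C0_gt0 hed c_ge0 (fun x => poweR_ge0 _ _) Ile.
set X := A * N `^ q * l `^ (n%:R - e * p).
have X0 : 0 <= X by rewrite !mulr_ge0 ?powR_ge0.
move=> int_le; have {}int_le : (\int[mu]_(x in cube a l) I x <= (c * T * X)%:E)%E.
  apply: (le_trans int_le); rewrite lee_fin ler_wpM2r//.
  by rewrite ler_wpM2l// ler_norm.
have qi0 : 0 <= q^-1 by rewrite invr_ge0 ltW.
have iI0 : (0 <= \int[mu]_(x in cube a l) I x)%E.
  by apply: integral_ge0 => x _; exact: poweR_ge0.
have := ge0_le_poweR qi0 iI0 int_le; rewrite poweR_EFin => root_le.
rewrite vol_cube//.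
have v0 : (0 <= ((l ^+ n) `^ (q0^-1 - q^-1))%:E)%E by rewrite lee_fin powR_ge0.
apply: (le_trans (lee_wpmul2l v0 root_le)).
rewrite poweR_EFin -!EFinM lee_fin.
have T0 : 0 <= c * T by rewrite mulr_ge0// normr_ge0.
have XE : X `^ q^-1 = A `^ q^-1 * N * l `^ ((n%:R - e * p) * q^-1).
  have AN0 : 0 <= A * N `^ q by rewrite mulr_ge0 ?powR_ge0.
  rewrite /X (powRM _ AN0 (powR_ge0 _ _)) (powRM _ A0 (powR_ge0 _ _)).
  by rewrite -!powRrM divff ?gt_eqF// (powRr1 (ltW N0)).
rewrite (powRM _ T0 X0) XE -(powR_mulrn n (ltW l0)) -powRrM.
(* The powers of l cancel because q/q_0 = p/p_0. *)
have lE : l `^ (n%:R * (q0^-1 - q^-1)) * l `^ ((n%:R - e * p) * q^-1) = 1.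
  rewrite -powRD; last by rewrite (gt_eqF l0) implybT.
  have -> : n%:R * (q0^-1 - q^-1) + (n%:R - e * p) * q^-1 = 0.
    rewrite q0E qE /e; field.
    by rewrite (gt_eqF p0_gt0) (gt_eqF theta0) (gt_eqF p_gt0).
  by rewrite powRr0.
have -> : l `^ (n%:R * (q0^-1 - q^-1)) *
    ((c * T) `^ q^-1 * (A `^ q^-1 * N * l `^ ((n%:R - e * p) * q^-1))) =
    (c * T) `^ q^-1 * A `^ q^-1 * N *
    (l `^ (n%:R * (q0^-1 - q^-1)) * l `^ ((n%:R - e * p) * q^-1)) by ring.
rewrite lE mulr1; apply: ler_wpM2r; first exact: ltW.
by apply: ler_wpM2r; [exact: powR_ge0|rewrite lerDl].
Qed.
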